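(* Let $X$ be a Kaplansky module over $C(K)$, let $U$ be a $d$-isomorphism of $X$ with $\sigma(U)\subseteq\mathbb{T}$ (the unit circle), let $w\in C(K)$ and $T=wU$. Let $\varphi$ be the homeomorphism of $K$ onto itself such that $UfU^{-1}=f\circ\varphi$ for all $f\in C(K)$, and let $S$ be the operator on $C(K)$ defined by $(Sf)(k)=w(k)f(\varphi(k))$, $f\in C(K)$, $k\in K$. Assume that $\varphi$ has no periodic points in $K$. Then $$\sigma_{a.p.}(T)=\sigma_{a.p.}(S)\quad\text{and}\quad\sigma_r(T)=\sigma_r(S).$$
   Context: All spaces are over $\mathbb{C}$; $L(X)$ is the algebra of bounded linear operators on $X$. Banach $C(K)$-module: $K$ is a compact Hausdorff space, $X$ a Banach space, $m:C(K)\to L(X)$ a bounded unital homomorphism. It is always assumed that $m$ is injective and isometric and that $m(C(K))$ is closed in $L(X)$ in the weak operator topology; $f\in C(K)$ is identified with $m(f)$. For $x\in X$ the cyclic subspace $X(x)=\mathrm{cl}\{fx: f\in C(K)\}$, with the norm of $X$ and the cone $X_+(x)=\mathrm{cl}\{fx: f\in C(K), f\ge0\}$, is a (complex) Banach lattice. $X$ is a Kaplansky module if $K$ is extremally disconnected and for every $x$ the set $\{f\in C(K): fx=0\}$ is a band in $C(K)$. $d$-endomorphism: $T\in L(X)$ such that for every $x\in X$, $T(X(x))\subseteq X(Tx)$ and $T|X(x):X(x)\to X(Tx)$ is disjointness preserving ($u\perp v\Rightarrow Tu\perp Tv$). A $d$-isomorphism is an invertible $d$-endomorphism whose inverse is also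 a $d$-endomorphism. For a $d$-isomorphism $U$ of a Kaplansky module the map $f\mapsto UfU^{-1}$ is an automorphism of $C(K)$, hence induced by a homeomorphism $\varphi$ of $K$. A point $k$ is $\varphi$-periodic if $\varphi^m(k)=k$ for some $m\in\mathbb{N}$. $\sigma_{a.p.}(A)=\{\lambda\in\mathbb{C}:\exists x_n,\ \|x_n\|=1,\ Ax_n-\lambda x_n\to0\}$; $\sigma_r(A)=\sigma(A)\setminus\sigma_{a.p.}(A)$. *)

(* Defs.v *)
From HB Require Import structures.
From mathcomp Require Import all_boot all_order all_algebra.
From mathcomp Require Import all_classical all_reals all_analysis.
From mathcomp Require Import complex.

Set Implicit Arguments.
Unset Strict Implicit.
Unset Printing Implicit Defensive.

Import Order.TTheory GRing.Theory Num.Theory.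
Import numFieldNormedType.Exports.
Import Normc.

Local Open Scope classical_set_scope.
Local Open Scope complex_scope.
Local Open Scope ring_scope.

(* The norm topology of R[i]; the library only provides it on R[i]^o. *)
HB.instance Definition _ (R : realType) := NormedModule.copy R[i] R[i]^o.

Section supnorm.
Variables (R : realType) (V : normedModType R[i]).
Implicit Types (x y : V).

(* Norms over R[i] are R[i]-valued; rnorm is the same norm valued in R. *)
Definition rnorm x : R := complex.Re `|x|.

Lemma rnormE x : `|x| = (rnorm x)%:C.
Proof. by rewrite RRe_real ?ger0_real. Qed.

Lemma rnorm_ge0 x : 0 <= rnorm x.
Proof. by rewrite -lecR -rnormE; exact: normr_ge0. Qed.

Lemma rnormD x y : rnorm (x + y) <= rnorm x + rnorm y.
Proof. by rewrite -lecR rmorphD/= -!rnormE ler_normD. Qed.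

Lemma rnormZ (a : R[i]) x : rnorm (a *: x) = normc a * rnorm x.
Proof. by apply: complexI; rewrite rmorphM/= -!rnormE normrZ. Qed.

Lemma rnorm0_eq0 x : rnorm x = 0 -> x = 0.
Proof. by move=> x0; apply/normr0_eq0; rewrite rnormE x0. Qed.

Lemma rnormN x : rnorm (- x) = rnorm x.
Proof. by rewrite /rnorm normrN. Qed.

Lemma ler_dist_rnorm x y : `|rnorm x - rnorm y| <= rnorm (x - y).
Proof.
wlog xy : x y / rnorm y <= rnorm x.
  move=> H; have [/H//|/ltW/H] := leP (rnorm y) (rnorm x).
  by rewrite distrC -[x - y]opprB rnormN.
by rewrite ger0_norm ?subr_ge0// lerBlDr -{1}(subrK y x) rnormD.
Qed.

Lemma rnorm_continuous : continuous (rnorm : V -> R).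
Proof.
move=> x; apply/cvgrPdist_lt => e e0; near=> y.
rewrite (le_lt_trans (ler_dist_rnorm _ _))// -ltcR -rnormE.
by near: y; apply: cvgr_dist_lt => //; rewrite ltcR.
Unshelve. all: by end_near. Qed.

Variables (I : Type) (A : set I).
Implicit Types (f g : I -> V).

Definition rsup f : R := sup [set rnorm (f i) | i in A].

Definition supnorm f : R[i] := (rsup f)%:C.

Definition bounded_fam f := exists M : R, forall i, A i -> rnorm (f i) <= M.

Lemma rsup_le f M : 0 <= M -> (forall i, A i -> rnorm (f i) <= M) -> rsup f <= M.
Proof.
move=> M0 fM; rewrite /rsup.
have [->|/set0P S0] := eqVneq [set rnorm (f i) | i in A] set0.
  by rewrite sup0.
by apply: ge_sup => // _ [i Ai <-]; exact: fM.
Qed.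

Lemma le_rsup f i : bounded_fam f -> A i -> rnorm (f i) <= rsup f.
Proof.
move=> [M fM] Ai; apply: ub_le_sup; last by exists i.
by exists M => _ [j Aj <-]; exact: fM.
Qed.

Lemma rsup_ge0 f : bounded_fam f -> 0 <= rsup f.
Proof.
move=> bf; have [[i Ai]|/set0P/negP/negPn/eqP A0] := pselect (A !=set0).
  exact: le_trans (rnorm_ge0 (f i)) (le_rsup bf Ai).
by rewrite /rsup A0 image_set0 sup0.
Qed.

Lemma supnormD f g : bounded_fam f -> bounded_fam g ->
  supnorm (fun i => f i + g i) <= supnorm f + supnorm g.
Proof.
move=> bf bg; rewrite /supnorm -rmorphD/= lecR.
apply: rsup_le => [|i Ai]; first by rewrite addr_ge0 ?rsup_ge0.
by rewrite (le_trans (rnormD _ _))// lerD// le_rsup.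
Qed.

Lemma bounded_famZ (a : R[i]) f :
  bounded_fam f -> bounded_fam (fun i => a *: f i).
Proof.
move=> [M fM]; exists (normc a * M) => i Ai; rewrite rnormZ.
by rewrite ler_wpM2l ?fM// -lecR; exact: (normr_ge0 a).
Qed.

Lemma rsupZ_le (a : R[i]) f : bounded_fam f ->
  rsup (fun i => a *: f i) <= normc a * rsup f.
Proof.
move=> bf; have a0 : 0 <= normc a by rewrite -lecR; exact: (normr_ge0 a).
apply: rsup_le => [|i Ai]; first by rewrite mulr_ge0// rsup_ge0.
by rewrite rnormZ ler_wpM2l// le_rsup.
Qed.

Lemma supnormZ (a : R[i]) f : bounded_fam f ->
  supnorm (fun i => a *: f i) = `|a| * supnorm f.
Proof.
move=> bf; rewrite /supnorm -[`|a|]/((normc a)%:C) -rmorphM/=; congr (_%:C).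
have a0 : 0 <= normc a by rewrite -lecR; exact: (normr_ge0 a).
apply/eqP; rewrite eq_le rsupZ_le//=.
have [->|an0] := eqVneq a 0.
  by rewrite normc0 mul0r rsup_ge0//; exact: bounded_famZ.
have na0 : 0 < normc a.
  by rewrite lt_def a0 andbT; apply: contra an0 => /eqP/eq0_normc ->.
have := rsupZ_le a^-1 (bounded_famZ a bf).
rewrite (_ : (fun i => _) = f); last first.
  by apply/funext => i; rewrite scalerA mulVf// scale1r.
by rewrite normcV ler_pdivlMl.
Qed.

Lemma supnorm_eq0 f i : bounded_fam f -> supnorm f = 0 -> A i -> f i = 0.
Proof.
move=> bf /complexI s0 Ai; apply/rnorm0_eq0/eqP.
by rewrite eq_le rnorm_ge0 andbT -s0 le_rsup.
Qed.

End supnorm.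

HB.mixin Record isCompactHausdorff K & Topological K := {
  compact_setT : compact [set: K];
  hausdorffT : hausdorff_space K
}.

#[short(type="compactHausdorffType")]
HB.structure Definition CompactHausdorff :=
  {K of Topological K & isCompactHausdorff K}.

Section continuous_functions.
Variables (R : realType) (K : compactHausdorffType).

Definition CK := continuousType K R[i].
HB.instance Definition _ := Choice.on CK.
Implicit Types f g h : CK.

Lemma CK_cont f : continuous (f : K -> R[i]).
Proof. exact: cts_fun. Qed.

Lemma CKP f g : (forall k, f k = g k) -> f = g.
Proof. by move=> fg; apply/continuousEP. Qed.

Definition mkCK (f : K -> R[i]) (cf : continuous f) : CK := mkcts cf.

Lemma CK_add_cont f g : continuous (fun k => f k + g k).
Proof. by move=> k; apply: (@continuousD _ _ K); exact: CK_cont. Qed.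

Lemma CK_opp_cont f : continuous (fun k => - f k).
Proof. by move=> k; apply: (@continuousN _ _ K); exact: CK_cont. Qed.

Lemma CK_mul_cont f g : continuous (fun k => f k * g k).
Proof. by move=> k; apply: (@continuousM R[i] K); exact: CK_cont. Qed.

Definition CK_cst (c : R[i]) : CK := cst c.
Definition CK_add f g := mkCK (@CK_add_cont f g).
Definition CK_opp f := mkCK (@CK_opp_cont f).
Definition CK_mul f g := mkCK (@CK_mul_cont f g).
Definition CK_scale (a : R[i]) f := CK_mul (CK_cst a) f.

Lemma CK_addA : associative CK_add.
Proof. by move=> f g h; apply: CKP => k; exact: addrA. Qed.
Lemma CK_addC : commutative CK_add.
Proof. by move=> f g; apply: CKP => k; exact: addrC. Qed.
Lemma CK_add0 : left_id (CK_cst 0) CK_add.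
Proof. by move=> f; apply: CKP => k; exact: add0r. Qed.
Lemma CK_addN : left_inverse (CK_cst 0) CK_opp CK_add.
Proof. by move=> f; apply: CKP => k; exact: addNr. Qed.

HB.instance Definition _ :=
  GRing.isZmodule.Build CK CK_addA CK_addC CK_add0 CK_addN.

Lemma CK_mulA : associative CK_mul.
Proof. by move=> f g h; apply: CKP => k; exact: mulrA. Qed.
Lemma CK_mulC : commutative CK_mul.
Proof. by move=> f g; apply: CKP => k; exact: mulrC. Qed.
Lemma CK_mul1 : left_id (CK_cst 1) CK_mul.
Proof. by move=> f; apply: CKP => k; exact: mul1r. Qed.
Lemma CK_mulDl : left_distributive CK_mul CK_add.
Proof. by move=> f g h; apply: CKP => k; exact: mulrDl. Qed.

(* C(K) is the zero ring when K is empty, whence the Pz structure. *)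
HB.instance Definition _ :=
  GRing.Zmodule_isComPzRing.Build CK CK_mulA CK_mulC CK_mul1 CK_mulDl.

Lemma CK_scaleA a b f : CK_scale a (CK_scale b f) = CK_scale (a * b) f.
Proof. by apply: CKP => k; exact: mulrA. Qed.
Lemma CK_scale1 : left_id 1 CK_scale.
Proof. by move=> f; apply: CKP => k; exact: mul1r. Qed.
Lemma CK_scaleDr : right_distributive CK_scale +%R.
Proof. by move=> a f g; apply: CKP => k; exact: mulrDr. Qed.
Lemma CK_scaleDl f : {morph CK_scale^~ f : a b / a + b}.
Proof. by move=> a b; apply: CKP => k; exact: mulrDl. Qed.

HB.instance Definition _ := GRing.Zmodule_isLmodule.Build R[i] CK
  CK_scaleA CK_scale1 CK_scaleDr CK_scaleDl.

Lemma CK_bounded f : bounded_fam [set: K] (f : K -> R[i]).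
Proof.
have cf : continuous (fun k => rnorm (f k)).
  by move=> k; apply: continuous_comp; [exact: CK_cont|exact: rnorm_continuous].
have /compact_bounded[M [_ /(_ (M + 1))]] :
    compact ((fun k => rnorm (f k)) @` [set: K]).
  apply: continuous_compact; last exact: compact_setT.
  exact: continuous_subspaceT.
rewrite ltrDl ltr01 => /(_ isT) fM; exists (M + 1) => k _.
by rewrite (le_trans (ler_norm _))// fM//; exists k.
Qed.

Definition CK_norm f := supnorm [set: K] (f : K -> R[i]).

Lemma CK_normD f g : CK_norm (f + g) <= CK_norm f + CK_norm g.
Proof. by apply: supnormD; exact: CK_bounded. Qed.
Lemma CK_normZ a f : CK_norm (a *: f) = `|a| * CK_norm f.
Proof. by apply: supnormZ; exact: CK_bounded. Qed.
Lemma CK_norm0_eq0 f : CK_norm f = 0 -> f = 0.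
Proof.
by move=> f0; apply: CKP => k; apply: (supnorm_eq0 (CK_bounded f) f0).
Qed.

HB.instance Definition _ := Lmodule_isNormed.Build R[i] CK
  CK_normD CK_normZ CK_norm0_eq0.

End continuous_functions.

HB.structure Definition ContinuousLinear (R : realType)
    (X Y : normedModType R[i]) :=
  {f of @GRing.Linear R[i] X Y *:%R f & @Continuous X Y f}.

(* Bounded linear operators: on normed spaces, linear and continuous. *)
Notation "''L' ( X , Y )" := (ContinuousLinear.type X Y)
  (at level 8, format "''L' ( X ,  Y )") : type_scope.

Section bounded_operators.
Variables (R : realType) (X Y : normedModType R[i]).

HB.instance Definition _ := gen_eqMixin 'L(X, Y).
HB.instance Definition _ := gen_choiceMixin 'L(X, Y).
Implicit Types S T : 'L(X, Y).

Lemma LP S T : (forall x, S x = T x) -> S = T.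
Proof.
case: S T => [S [[Sa] [Ss] [Sc]]] [T [[Ta] [Ts] [Tc]]]/= /funext ST.
rewrite ST in Sa Ss Sc *.
by rewrite (Prop_irrelevance Sa Ta) (Prop_irrelevance Ss Ts)
  (Prop_irrelevance Sc Tc).
Qed.

Lemma L_cont T : continuous (T : X -> Y).
Proof. exact: cts_fun. Qed.

Definition mkL (f : X -> Y) (lf : linear f) (cf : continuous f) : 'L(X, Y) :=
  HB.pack_for 'L(X, Y) f (GRing.isLinear.Build R[i] X Y *:%R f lf)
    (isContinuous.Build X Y f cf).

Lemma L0_lin : linear ((fun=> 0) : X -> Y).
Proof. by move=> a x y; rewrite scaler0 addr0. Qed.
Lemma L0_cont : continuous ((fun=> 0) : X -> Y).
Proof. by move=> x; exact: cvg_cst. Qed.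

Lemma LD_lin S T : linear (fun x => S x + T x).
Proof. by move=> a x y; rewrite !linearP scalerDr addrACA. Qed.
Lemma LD_cont S T : continuous (fun x => S x + T x).
Proof. by move=> x; apply: continuousD; exact: L_cont. Qed.

Lemma LN_lin T : linear (fun x => - T x).
Proof. by move=> a x y; rewrite linearP opprD scalerN. Qed.
Lemma LN_cont T : continuous (fun x => - T x).
Proof. by move=> x; apply: continuousN; exact: L_cont. Qed.

Lemma LZ_lin (b : R[i]) T : linear (fun x => b *: T x).
Proof. by move=> a x y; rewrite linearP scalerDr !scalerA mulrC. Qed.
Lemma LZ_cont (b : R[i]) T : continuous (fun x => b *: T x).
Proof. by move=> x; apply: cvgZr; exact: L_cont. Qed.

Definition L_zero := mkL L0_lin L0_cont.
Definition L_add S T := mkL (LD_lin S T) (@LD_cont S T).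
Definition L_opp T := mkL (LN_lin T) (@LN_cont T).
Definition L_scale b T := mkL (LZ_lin b T) (@LZ_cont b T).

Lemma L_addA : associative L_add.
Proof. by move=> S T U; apply: LP => x; exact: addrA. Qed.
Lemma L_addC : commutative L_add.
Proof. by move=> S T; apply: LP => x; exact: addrC. Qed.
Lemma L_add0 : left_id L_zero L_add.
Proof. by move=> S; apply: LP => x; exact: add0r. Qed.
Lemma L_addN : left_inverse L_zero L_opp L_add.
Proof. by move=> S; apply: LP => x; exact: addNr. Qed.

HB.instance Definition _ :=
  GRing.isZmodule.Build 'L(X, Y) L_addA L_addC L_add0 L_addN.

Lemma L_scaleA a b T : L_scale a (L_scale b T) = L_scale (a * b) T.
Proof. by apply: LP => x; exact: scalerA. Qed.
Lemma L_scale1 : left_id 1 L_scale.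
Proof. by move=> T; apply: LP => x; exact: scale1r. Qed.
Lemma L_scaleDr : right_distributive L_scale +%R.
Proof. by move=> a S T; apply: LP => x; exact: scalerDr. Qed.
Lemma L_scaleDl T : {morph L_scale^~ T : a b / a + b}.
Proof. by move=> a b; apply: LP => x; exact: scalerDl. Qed.

HB.instance Definition _ := GRing.Zmodule_isLmodule.Build R[i] 'L(X, Y)
  L_scaleA L_scale1 L_scaleDr L_scaleDl.

Definition unit_ball : set X := [set x | `|x| <= 1].

Lemma L_bounded T : bounded_fam unit_ball T.
Proof.
have /linear_boundedP/pinfty_ex_gt0[r r0 Tr] : bounded_near T (nbhs (0 : X)).
  by apply: continuous_linear_bounded; exact: L_cont.
exists (complex.Re r) => x x1; rewrite -lecR -rnormE RRe_real ?gtr0_real//.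
by rewrite (le_trans (Tr x))// ler_piMr// ltW.
Qed.

Definition opnorm T := supnorm unit_ball T.

Lemma opnormD S T : opnorm (S + T) <= opnorm S + opnorm T.
Proof. by apply: supnormD; exact: L_bounded. Qed.
Lemma opnormZ a T : opnorm (a *: T) = `|a| * opnorm T.
Proof. by apply: supnormZ; exact: L_bounded. Qed.
Lemma opnorm0_eq0 T : opnorm T = 0 -> T = 0.
Proof.
move=> T0; apply: LP => x.
have [->|x0] := eqVneq x 0; first by rewrite linear0.
have nx0 : `|x|^-1 != 0 by rewrite invr_eq0 normr_eq0.
apply/eqP; rewrite -[_ == _]orFb -(negbTE nx0) -scaler_eq0 -linearZ/=.
apply/eqP/(supnorm_eq0 (L_bounded T) T0); rewrite /unit_ball/= normrZ.
by rewrite normfV normr_id mulVf// normr_eq0.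
Qed.

HB.instance Definition _ := Lmodule_isNormed.Build R[i] 'L(X, Y)
  opnormD opnormZ opnorm0_eq0.

End bounded_operators.

HB.instance Definition _ (R : realType) (X Y Z : normedModType R[i])
    (S : 'L(X, Y)) (T : 'L(Y, Z)) :=
  GRing.Linear.on (T \o S).
HB.instance Definition _ (R : realType) (X : normedModType R[i]) :=
  GRing.Linear.on (@idfun X).

Section weighted_composition.
Variables (R : realType) (K : compactHausdorffType).
Implicit Types f w : CK R K.

Definition CK_comp f (phi : continuousType K K) : CK R K :=
  (f : continuousType K R[i]) \o phi.

Definition wcomp w (phi : continuousType K K) f : CK R K := w * CK_comp f phi.

Lemma wcompE w phi f k : wcomp w phi f k = w k * f (phi k).
Proof. by []. Qed.

Lemma wcomp_lin w phi : linear (wcomp w phi).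
Proof.
move=> a f g; apply: CKP => k.
rewrite wcompE -[LHS]/(w k * (a * f (phi k) + g (phi k))).
by rewrite mulrDr mulrCA.
Qed.

Lemma CK_norm_le f k : `|f k| <= `|f|.
Proof.
by rewrite -[`|f|]/(_%:C) rnormE lecR;
  exact: (le_rsup (CK_bounded f) (I : [set: K] k)).
Qed.

Lemma wcomp_norm w phi f : `|wcomp w phi f| <= `|w| * `|f|.
Proof.
have cb (g : CK R K) k : rnorm (g k) <= rsup [set: K] (g : K -> R[i]).
  exact: (le_rsup (CK_bounded g) (I : [set: K] k)).
rewrite -[`|w|]/(_%:C) -[`|f|]/(_%:C) -[`|wcomp _ _ _|]/(_%:C).
rewrite -rmorphM lecR; apply: rsup_le => [|k _].
  by rewrite mulr_ge0// rsup_ge0//; exact: CK_bounded.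
rewrite wcompE -[w k * _]/(w k *: f (phi k)) rnormZ.
by rewrite ler_pM ?rnorm_ge0 ?cb//; exact: (@rnorm_ge0 R R[i] (w k)).
Qed.

Lemma wcomp_cont w phi : continuous (wcomp w phi).
Proof.
pose L := HB.pack_for {linear CK R K -> CK R K} (wcomp w phi)
  (GRing.isLinear.Build R[i] (CK R K) (CK R K) *:%R _ (wcomp_lin w phi)).
apply: (@bounded_linear_continuous _ _ _ L); apply/linear_boundedP.
near=> r => f; rewrite (le_trans (wcomp_norm w phi f))// ler_wpM2r//.
Unshelve. all: by end_near. Qed.

Definition weighted_comp w phi : 'L(CK R K, CK R K) :=
  mkL (wcomp_lin w phi) (@wcomp_cont w phi).

End weighted_composition.

Section spectra.
Variables (R : realType) (X : normedModType R[i]).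
Implicit Types A B : 'L(X, X).

Definition is_inverse A B := cancel A B /\ cancel B A.

Definition spectrum A : set R[i] :=
  [set l | ~ exists B, is_inverse (A - l *: (idfun : 'L(X, X))) B].

Definition ap_spectrum A : set R[i] :=
  [set l | exists x : nat -> X, (forall n, `|x n| = 1) /\
    (A (x n) - l *: x n) @[n --> \oo] --> (0 : X)].

Definition res_spectrum A : set R[i] := spectrum A `\` ap_spectrum A.

(* 'L(X, X) with the weak operator topology: the coarsest topology making
   every T |-> y (T x), x in X, y in the dual of X, continuous. *)
Definition wot_eval (T : 'L(X, X)) : {ptws X * 'L(X, R[i]) -> R[i]} :=
  fun p => p.2 (T p.1).
Definition wot : Type := initial_topology wot_eval.
HB.instance Definition _ := Topological.copy wot (initial_topology wot_eval).

End spectra.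

(* Order notions in a complex vector space with a cone P; the real elements
   are those of P - P, and u = r + i s with r, s real. *)
Section complex_vector_lattice.
Variables (R : realType) (X : lmodType R[i]) (P : set X).
Implicit Types (u v p q r s : X) (D : set X).

Definition cone_le u v := P (v - u).

Definition is_lub D p :=
  (forall r, D r -> cone_le r p) /\
  (forall q, (forall r, D r -> cone_le r q) -> cone_le p q).

Definition is_glb D p :=
  (forall r, D r -> cone_le p r) /\
  (forall q, (forall r, D r -> cone_le q r) -> cone_le q p).

Definition real_elt : set X := [set p - q | p in P & q in P].

Definition is_re u r := real_elt r /\ exists2 s, real_elt s & u = r + 'i *: s.

(* |u| = sup {Re (c u) : |c| = 1} *)
Definition is_modulus u p :=
  is_lub [set r | exists2 c : R[i], `|c| = 1 & is_re (c *: u) r] p.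

Definition disjoint_elt u v := exists p q,
  [/\ is_modulus u p, is_modulus v q & is_glb [set p; q] 0].

End complex_vector_lattice.

Definition extremally_disconnected (K : topologicalType) :=
  forall U : set K, open U -> open (closure U).

Section modules.
Variables (R : realType) (K : compactHausdorffType).
Variable X : completeNormedModType R[i].

Definition CK_pos : set (CK R K) := [set f | forall k, 0 <= f k].

Definition CK_real : set (CK R K) := [set f | forall k, f k \is Num.real].

(* Band of the complex Banach lattice C(K): a solid subspace containing the
   supremum, taken in C(K) and not pointwise, of any nonempty set of its real
   elements that has one. *)
Record is_band (B : set (CK R K)) : Prop := {
  band0 : B 0;
  bandP : forall (a : R[i]) f g, B f -> B g -> B (a *: f + g);
  band_solid : forall f g : CK R K,
    (forall k, `|g k| <= `|f k|) -> B f -> B g;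
  band_sup : forall (D : set (CK R K)) f,
    D !=set0 -> D `<=` B `&` CK_real -> is_lub CK_pos D f -> B f
}.

Record is_CK_module (m : CK R K -> 'L(X, X)) : Prop := {
  module_linear : linear m;
  moduleM : forall f g x, m (f * g) x = m f (m g x);
  module1 : forall x, m 1 x = x;
  module_bounded : exists M : R[i], forall f, `|m f| <= M * `|f|;
  module_inj : injective m;
  module_isom : forall f, `|m f| = `|f|;
  module_closed : closed (range m : set (wot X))
}.

Implicit Type m : CK R K -> 'L(X, X).

Definition cyclic m (x : X) : set X := closure [set m f x | f in [set: CK R K]].

Definition cyclic_cone m (x : X) : set X := closure [set m f x | f in CK_pos].

Record is_Kaplansky_module m : Prop := {
  Kaplansky_module : is_CK_module m;
  Kaplansky_extr : extremally_disconnected K;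
  Kaplansky_band : forall x, is_band [set f | m f x = 0]
}.

Definition d_endomorphism m (T : 'L(X, X)) := forall x,
  T @` cyclic m x `<=` cyclic m (T x) /\
  forall u v, cyclic m x u -> cyclic m x v ->
    disjoint_elt (cyclic_cone m x) u v ->
    disjoint_elt (cyclic_cone m (T x)) (T u) (T v).

Definition d_isomorphism m (U : 'L(X, X)) := exists V,
  [/\ is_inverse U V, d_endomorphism m U & d_endomorphism m V].

End modules.

Definition homeomorphism (K : topologicalType) (phi : continuousType K K) :=
  exists psi : continuousType K K, cancel phi psi /\ cancel psi phi.

Definition periodic_point (T : Type) (phi : T -> T) (k : T) :=
  exists2 n, (0 < n)%N & iter n phi k = k.

(* Main.v *)
(* A nonzero spectral value is scaled to 1.  Write w_n for the n-th cocycle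
   product of w, so that T^n = w_n U^n.  Since sigma(U) lies in the circle, the
   norms of U^n and U^-n grow subexponentially, so at an exponential scale the
   behaviour of T is governed by w_n alone, and the same argument serves for X
   and for C(K) as a module over itself.

   Suppose that for some r < 1 and all large n every k satisfies
   |w_n(k)| <= r^n or |w_n(phi^-n k)| >= r^-n.  Then a clopen set splits x into
   two pieces, each of which T^n x - x controls up to a small multiple of |x|,
   and T - 1 is bounded below.  Otherwise there are long orbit segments about
   some k violating both alternatives, and, k not being periodic, a vector y
   supported on a small clopen neighbourhood of k generates a tower
   ..., T^-1 y, y, T y, ... with disjoint supports; its sum weighted by a slowly
   decaying function of the distance along the orbit is an approximate
   eigenvector.  The criterion with the inequalities reversed decides in the
   same way whether T - 1 is surjective, once it is bounded below: where it
   fails, the equation is solved approximately on two clopen pieces and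
   iterated; where it holds, a Combes-Thomas estimate (conjugation by the slowly
   growing weight) shows that the solution z of T z - z = y decays exponentially
   along the tower, which forces y = 0.

   The subexponential growth of U^n is obtained without complex analysis, from
   (1 - u^2 A^2)^-1 = ((1 - u A)^-1 + (1 + u A)^-1) / 2 applied along the powers
   A = U^(2^k). *)
Require Import Defs.
From HB Require Import structures.
From mathcomp Require Import all_boot all_order all_algebra.
From mathcomp Require Import all_classical all_reals all_analysis.
From mathcomp Require Import complex.
From mathcomp Require Import ring lra.

Import Order.TTheory GRing.Theory Num.Theory.
Import numFieldNormedType.Exports.
Import Normc.

Local Open Scope classical_set_scope.
Local Open Scope ring_scope.

Set Implicit Arguments.
Unset Strict Implicit.

(** * Estimates for scalars and for iterates of a bounded operator *)

Section scalars.
Variable R : realType.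
Implicit Types z : R[i].

Lemma rnorm_normc z : rnorm z = normc z. Proof. by []. Qed.

Lemma normc_ge0 z : 0 <= normc z.
Proof. by rewrite -rnorm_normc rnorm_ge0. Qed.

Lemma normc_real (r : R) : normc (r%:C)%C = `|r|.
Proof. by rewrite /= expr0n addr0 sqrtr_sqr. Qed.

Lemma normcX z n : normc (z ^+ n) = normc z ^+ n.
Proof. by elim: n => [|n IH]; rewrite ?normc1 // !exprS normcM IH. Qed.

Lemma exp_small (r e : R) : 0 <= r -> r < 1 -> 0 < e ->
  exists N, forall n, (N <= n)%N -> r ^+ n <= e.
Proof.
move=> r0 r1 e0.
have /cvgrPdist_le/(_ e e0)[N _ H] : r ^+ n @[n --> \oo] --> (0 : R).
  by apply: cvg_expr; rewrite ger0_norm.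
exists N => n Nn; have := H n Nn.
by rewrite /= sub0r normrN ger0_norm// exprn_ge0.
Qed.

End scalars.

Section operators.
Variables (R : realType) (X : normedModType R[i]).
Implicit Types A : 'L(X, X).

Lemma rnorm0 : rnorm (0 : X) = 0.
Proof. by rewrite /rnorm normr0. Qed.

Lemma rnormB (x y : X) : rnorm (x - y) <= rnorm x + rnorm y.
Proof. by rewrite -(rnormN y) rnormD. Qed.

Lemma rnorm_sub (x y : X) : rnorm x <= rnorm (x - y) + rnorm y.
Proof. by rewrite -{1}(subrK y x) rnormD. Qed.

Lemma L_bound A : exists2 c : R, 0 <= c & forall x, rnorm (A x) <= c * rnorm x.
Proof.
have /linear_boundedP/pinfty_ex_gt0[r r0 Ar] : bounded_near A (nbhs (0 : X)).
  by apply: continuous_linear_bounded; exact: L_cont.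
exists (complex.Re r); first by rewrite -lecR RRe_real ?gtr0_real// ltW.
by move=> x; rewrite -lecR rmorphM/= -!rnormE RRe_real ?gtr0_real//; exact: Ar.
Qed.

Lemma L_iter_bound A n :
  exists2 c : R, 0 <= c & forall x, rnorm (iter n A x) <= c * rnorm x.
Proof.
have [c c0 Ac] := L_bound A; exists (c ^+ n); first exact: exprn_ge0.
move=> x; elim: n => [|n IH]; first by rewrite mul1r.
by rewrite (le_trans (Ac _))// exprS -mulrA ler_wpM2l.
Qed.

Lemma L_iterB A n x y : iter n A (x - y) = iter n A x - iter n A y.
Proof. by elim: n => //= n ->; rewrite linearB. Qed.

Lemma L_iterD A n x y : iter n A (x + y) = iter n A x + iter n A y.
Proof. by elim: n => //= n ->; rewrite linearD. Qed.

Lemma iter_telescope A n x :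
  iter n A x - x = \sum_(i < n) iter i A (A x - x).
Proof.
elim: n => [|n IH]; first by rewrite big_ord0 subrr.
by rewrite big_ord_recr/= -IH L_iterB -iterSr/= addrC addrA subrK.
Qed.

Lemma telescope_bound A n :
  exists2 c : R, 0 <= c & forall x, rnorm (\sum_(i < n) iter i A x) <= c * rnorm x.
Proof.
elim: n => [|n [c c0 H]].
  by exists 0 => // x; rewrite big_ord0 rnorm0 mul0r.
have [c' c'0 H'] := L_iter_bound A n.
exists (c + c'); first exact: addr_ge0.
by move=> x; rewrite big_ord_recr mulrDl (le_trans (rnormD _ _))// lerD.
Qed.

Lemma telescope_right A n x :
  A (\sum_(i < n) iter i A x) - \sum_(i < n) iter i A x = iter n A x - x.
Proof.
elim: n => [|n IH]; first by rewrite !big_ord0 linear0 !subrr.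
rewrite big_ord_recr/= linearD opprD addrACA IH.
by rewrite addrC addrA subrK.
Qed.

End operators.

(** * Clopen sets and continuous functions on an extremally disconnected space *)

Section stonean.
Variables (R : realType) (K : compactHausdorffType).
Implicit Types (f : CK R K) (A : set K).

Lemma CK_normc_cont f : continuous (fun k => normc (f k)).
Proof.
by move=> k; apply: (@continuous_comp _ _ _ f (@rnorm R R[i]));
  [exact: CK_cont|exact: rnorm_continuous].
Qed.

Lemma open_normc_lt f c : open [set k | normc (f k) < c].
Proof.
apply: (@open_comp _ _ (fun k => normc (f k)) [set x | x < c]); last exact: open_lt.
by move=> k _; exact: CK_normc_cont.
Qed.

Lemma open_normc_gt f c : open [set k | c < normc (f k)].
Proof.
apply: (@open_comp _ _ (fun k => normc (f k)) [set x | c < x]); last exact: open_gt.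
by move=> k _; exact: CK_normc_cont.
Qed.

Lemma closed_normc_le f c : closed [set k | normc (f k) <= c].
Proof.
apply: (@closed_comp _ _ (fun k => normc (f k)) [set x | x <= c]); last exact: closed_le.
by move=> k _; exact: CK_normc_cont.
Qed.

Lemma closed_normc_ge f c : closed [set k | c <= normc (f k)].
Proof.
apply: (@closed_comp _ _ (fun k => normc (f k)) [set x | c <= x]); last exact: closed_ge.
by move=> k _; exact: CK_normc_cont.
Qed.

Lemma clopen_near A : clopen A -> forall k, \forall k' \near k, A k' <-> A k.
Proof.
move=> [oA cA] k; have [Ak|Ak] := pselect (A k).
  by near=> k'; split=> // _; near: k'; exact: open_nbhs_nbhs.
near=> k'; split=> // Ak'; exfalso; move: Ak'.
near: k'; apply: (@open_nbhs_nbhs _ k (~` A)); split=> //.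
exact: closed_openC.
Unshelve. all: by end_near. Qed.

Lemma clopen_indicator A : clopen A ->
  exists e : CK R K, forall k, e k = (k \in A)%:R.
Proof.
move=> cA; suff ce : continuous (fun k => (k \in A)%:R : R[i]).
  by exists (mkCK ce).
move=> k; apply: (@near_cst_continuous _ _ ((k \in A)%:R : R[i])).
near=> k'; congr (_%:R).
have : A k' <-> A k by near: k'; exact: clopen_near.
move=> H; congr nat_of_bool; apply/idP/idP; rewrite !inE; by move/H.
Unshelve. all: by end_near. Qed.

Lemma clopen_closure A :
  extremally_disconnected K -> open A -> clopen (closure A).
Proof. by move=> ed oA; split; [exact: ed|exact: closed_closure]. Qed.

(** The extension by zero is continuous because membership in a clopen set is locally constant. *)
Lemma clopen_inverse f A : clopen A -> (forall k, A k -> f k != 0) ->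
  exists v : CK R K, forall k, v k = if k \in A then (f k)^-1 else 0.
Proof.
move=> cA f0; suff ce : continuous (fun k => if k \in A then (f k)^-1 else 0).
  by exists (mkCK ce).
move=> k; have nA : \forall k' \near k, A k' <-> A k by exact: clopen_near.
have [Ak|Ak] := pselect (A k); last first.
  apply: (@near_cst_continuous _ _ (0 : R[i])); near=> k'.
  rewrite memNset//; have : A k' <-> A k by near: k'.
  by move=> [AA _] /AA.
rewrite /continuous_at (mem_set Ak).
apply: (@cvg_trans _ ((fun k => (f k)^-1) x @[x --> k])).
  apply: near_eq_cvg; near=> k'; rewrite mem_set//.
  have : A k' <-> A k by near: k'.
  by move=> [_]; apply.
by apply: cvgV; [exact: f0|exact: CK_cont].
Unshelve. all: by end_near. Qed.

Lemma closure_sub_closed (B C : set K) :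
  closed C -> B `<=` C -> forall k, closure B k -> C k.
Proof. by move=> cC BC k Bk; apply/cC/(closure_subset BC). Qed.

(** The closure of an open neighbourhood of [k] is clopen and misses every open neighbourhood of
    [k'] disjoint from that neighbourhood. *)
Lemma clopen_separation (ed : extremally_disconnected K) (k k' : K) :
  k <> k' -> exists A, [/\ clopen A, A k & ~ A k'].
Proof.
move=> kk'; have /eqP neq := kk'.
have := @hausdorffT K; rewrite open_hausdorff => /(_ k k' neq).
move=> [[B C]/= [kB kC] [oB oC /eqP BC0]].
exists (closure B); split; first exact: clopen_closure.
  by apply: subset_closure; rewrite inE in kB.
move=> /(_ C) H; have [y] : B `&` C !=set0.
  by apply: H; apply: open_nbhs_nbhs; split=> //; rewrite inE in kC.
by rewrite BC0.
Qed.

End stonean.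

(** * Lower bounds and surjectivity *)

Lemma iter_can (T : Type) (f g : T -> T) n :
  cancel f g -> cancel (iter n f) (iter n g).
Proof.
move=> fK; elim: n => // n IH x.
by rewrite [iter n.+1 g _]iterSr [iter n.+1 f _]iterS fK IH.
Qed.

Lemma iter_cont (K : topologicalType) (phi : continuousType K K) n :
  continuous (iter n phi).
Proof.
elim: n => [|n IH] k; first exact: cvg_id.
by apply: (@continuous_comp _ _ _ (iter n phi) phi); [exact: IH|exact: cts_fun].
Qed.

(** * Cocycle products and their behaviour along orbits *)

Section cocycle.
Variables (R : realType) (K : compactHausdorffType).
Implicit Types (f w : CK R K) (phi psi : continuousType K K).

Definition compn phi n f : CK R K := iter n (fun g => CK_comp g phi) f.

Lemma compnE phi n f k : compn phi n f k = f (iter n phi k).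
Proof.
elim: n k => //= n IH k.
by rewrite -[LHS]/(compn phi n f (phi k)) IH -iterSr.
Qed.

(** The product of [w (iter i phi k)] over [i < n]. *)
Definition coc w phi n : CK R K := iter n (wcomp w phi) 1.

(* Along the orbit of k let f be the profile with f(k) = 1 and
   f (phi j) = f j / w j, which an eigenvector of f |-> w (f o phi) must follow.
   The inequalities say that, at distance n on both sides, f exceeds f(k) at
   most by the factor r^-n; the second notion is this one for the adjoint
   profile 1 / f. *)
Definition localized_orbits w phi psi := forall (r : R) N, 0 < r < 1 ->
  exists n k, [/\ (N <= n)%N, r ^+ n < normc (coc w phi n k) &
    normc (coc w phi n (iter n psi k)) < r ^- n].

Definition colocalized_orbits w phi psi := forall (r : R) N, 0 < r < 1 ->
  exists n k, [/\ (N <= n)%N, normc (coc w phi n k) < r ^- n &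
    r ^+ n < normc (coc w phi n (iter n psi k))].

End cocycle.

(** * Sufficient criteria for lower bounds and for surjectivity *)

Section weighted_operator.
Variables (R : realType) (K : compactHausdorffType) (X : normedModType R[i]).
Variables (m : CK R K -> 'L(X, X)) (U V : 'L(X, X)).
Variables (phi psi : continuousType K K).

(** Common ground of the module [X] with its [d]-isomorphism and of [C(K)] acting on itself: the
    criteria are derived from these properties once and then applied to both. *)
Record weighted_setup : Prop := {
  su_D : forall (f g : CK R K) (x : X), m (f + g) x = m f x + m g x;
  su_Z : forall (a : R[i]) (f : CK R K) (x : X), m (a *: f) x = a *: m f x;
  su_M : forall (f g : CK R K) (x : X), m (f * g) x = m f (m g x);
  su_1 : forall x, m 1 x = x;
  su_norm : forall (f : CK R K) (c : R) (x : X), 0 <= c -> (forall k, normc (f k) <= c) ->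
    rnorm (m f x) <= c * rnorm x;
  su_inj : forall f : CK R K, (forall x, m f x = 0) -> f = 0;
  su_extr : extremally_disconnected K;
  su_UK : cancel U V;
  su_VK : cancel V U;
  su_phiK : cancel phi psi;
  su_psiK : cancel psi phi;
  su_aper : forall k : K, ~ periodic_point phi k;
  su_com : forall (f : CK R K) (x : X), U (m f x) = m (CK_comp f phi) (U x);
  su_growth : forall e : R, 1 < e -> exists2 C : R, 0 < C & forall n (x : X),
    rnorm (iter n U x) <= C * e ^+ n * rnorm x /\
    rnorm (iter n V x) <= C * e ^+ n * rnorm x
}.

Hypothesis S : weighted_setup.
Implicit Types (f g : CK R K) (x y : X) (A : 'L(X, X)).

Lemma act_subr f g x : m (f - g) x = m f x - m g x.
Proof.
apply/eqP; rewrite -subr_eq opprK; apply/eqP.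
by rewrite -(su_D S) subrK.
Qed.

Lemma act_split f x : x = m f x + m (1 - f) x.
Proof. by rewrite -(su_D S) addrC subrK (su_1 S). Qed.

Lemma act_norm_le f x : (forall k, normc (f k) <= 1) -> rnorm (m f x) <= rnorm x.
Proof. by move=> f1; rewrite -[leRHS]mul1r (su_norm S). Qed.

Lemma iter_com n f x : iter n U (m f x) = m (compn phi n f) (iter n U x).
Proof. by elim: n => //= n IH; rewrite IH (su_com S). Qed.

Variable w : CK R K.
Let T : 'L(X, X) := m w \o U.

Lemma iterT n x : iter n T x = m (coc w phi n) (iter n U x).
Proof.
elim: n => [|n IH]; first by rewrite (su_1 S).
by rewrite iterS IH /T/= (su_com S) -(su_M S).
Qed.

Lemma iterT_com n f x : iter n T (m f x) = m (compn phi n f) (iter n T x).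
Proof.
by rewrite !iterT iter_com -!(su_M S) mulrC.
Qed.

Lemma iterT_small n (e : CK R K) x c D : 0 <= c ->
  (forall k, normc (coc w phi n k * e k) <= c) ->
  rnorm (iter n U x) <= D * rnorm x ->
  rnorm (m e (iter n T x)) <= c * D * rnorm x.
Proof.
move=> c0 ce HD; rewrite iterT -(su_M S) -mulrA.
apply: (le_trans (su_norm S (c := c) _ _ _)) => //.
  by move=> k; rewrite mulrC; exact: ce.
by rewrite ler_wpM2l.
Qed.

(** The constant carries no sign; where positivity matters, proofs pass to its absolute value plus
    1. *)
Definition bounded_below (A : 'L(X, X)) (l : R[i]) :=
  exists c, forall x, rnorm x <= c * rnorm (A x - l *: x).

(** With [e = (1 + 1/r) / 2] one has [r e = (1 + r) / 2 < 1], so decay at rate [r^n] outweighs the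
    growth [e^n] of the powers of [U] and [V]. *)
Lemma rate_choice (r eps : R) : 0 < r < 1 -> 0 < eps -> exists (e C : R) N,
  [/\ 1 < e, 0 < C, forall n (x : X), rnorm (iter n U x) <= C * e ^+ n * rnorm x /\
        rnorm (iter n V x) <= C * e ^+ n * rnorm x &
      forall n, (N <= n)%N -> C * (r * e) ^+ n <= eps].
Proof.
move=> /andP[r0 r1] eps0.
have re : r * ((1 + r^-1) / 2) = (1 + r) / 2.
  by rewrite mulrA mulrDr mulr1 divff ?gt_eqF// [r + 1]addrC.
have e1 : 1 < (1 + r^-1) / 2.
  have : 1 < r^-1 by rewrite invf_gt1.
  lra.
have [C C0 HC] := su_growth S e1.
have [||| N HN] := @exp_small R ((1 + r) / 2) (eps / C); [lra|lra|exact: divr_gt0|].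
exists ((1 + r^-1) / 2), C, N; split=> // n Nn.
by rewrite re mulrC -ler_pdivlMr// HN.
Qed.

Lemma rateU (r e C : R) n (x y : X) : 0 < r -> 0 < e -> 0 < C ->
  rnorm y <= r ^+ n * rnorm x ->
  (forall n (x : X), rnorm (iter n U x) <= C * e ^+ n * rnorm x /\
        rnorm (iter n V x) <= C * e ^+ n * rnorm x) ->
  rnorm (iter n U y) <= C * (r * e) ^+ n * rnorm x /\
  rnorm (iter n V y) <= C * (r * e) ^+ n * rnorm x.
Proof.
move=> r0 e0 C0 yx HC; have [HU HV] := HC n y.
have ub : C * e ^+ n * rnorm y <= C * (r * e) ^+ n * rnorm x.
  rewrite exprMn -!mulrA (ler_wpM2l (ltW C0))// mulrCA.
  by rewrite ler_wpM2l// exprn_ge0// ltW.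
by split; [exact: le_trans HU ub|exact: le_trans HV ub].
Qed.

Lemma normc_indicator (b : bool) : normc (b%:R : R[i]) <= 1.
Proof. by case: b; rewrite ?normc1 ?normc0. Qed.

(** [e] is the indicator of the clopen closure of the set where [normc (f k) < c], and [v] inverts
    [f] off that closure. The bound on [g] is a closed condition, hence reaches the closure. *)
Lemma threshold_split (f g : CK R K) (c d : R) : 0 < c -> 0 <= d ->
  (forall k, normc (f k) < c -> normc (g k) <= d) ->
  exists e v : CK R K, [/\ forall k, normc (e k) <= 1,
    forall k, normc (e k * g k) <= d, v * f = 1 - e &
    forall k, normc (v k) <= c^-1].
Proof.
move=> c0 d0 fg; pose B := closure [set k | normc (f k) < c].
have cB : clopen B.
  by apply: clopen_closure; [exact: su_extr|exact: open_normc_lt].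
have B1 : forall k, B k -> normc (g k) <= d.
  by apply: closure_sub_closed; [exact: closed_normc_le|exact: fg].
have B2 k : ~ B k -> c <= normc (f k).
  by move=> nB; rewrite leNgt; apply/negP => kn; apply/nB/subset_closure.
have f0 k : ~ B k -> f k != 0.
  by move=> /B2; apply: contraTneq => ->; rewrite normc0 -ltNge.
have [e eE] := @clopen_indicator R K B cB.
have [v vE] := @clopen_inverse R K f (~` B) (clopenC set0 cB) f0.
exists e, v; split=> [k|k||k].
- by rewrite eE normc_indicator.
- rewrite eE normcM; have [kB|kB] := pselect (B k).
    by rewrite mem_set// normc1 mul1r B1.
  by rewrite memNset// normc0 mul0r.
- apply: CKP => k; rewrite -[LHS]/(v k * f k) -[RHS]/(1 - e k) vE eE.
  have [kB|kB] := pselect (B k).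
    by rewrite memNset// mem_set//= mul0r subrr.
  by rewrite mem_set//= memNset// subr0 mulVf// f0.
rewrite vE; case: ifPn => [|_]; last by rewrite normc0 invr_ge0 ltW.
rewrite inE => /B2 H; rewrite normcV lef_pV2// posrE//.
exact: lt_le_trans H.
Qed.

(** Where [g] is 1, the cocycle [w_n] is at most [r^n], so [g T^n x] is small and [g x] is
    controlled by [T^n x - x]. On the rest [T^n] expands, and [x] is recovered from [T^n x] with a
    small factor. *)
Lemma bounded_below_of_not_localized :
  ~ localized_orbits w phi psi -> bounded_below T 1.
Proof.
move=> /existsNP[r /existsNP[N0 /not_implyP[r01 Hk]]].
have [|e [C [N [e1 C0 HC HN]]]] := @rate_choice r (1/4) r01; first by lra.
have /andP[r0 r1] := r01.
have e0 : 0 < e by apply: lt_trans e1.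
pose n := maxn N N0; have CHN := HN n (leq_maxl _ _).
have rn0 : 0 < r ^- n by rewrite invr_gt0 exprn_gt0.
have [|g [v [g1 gw vw v1]]] := @threshold_split (compn psi n (coc w phi n))
  (coc w phi n) _ _ rn0 (exprn_ge0 n (ltW r0)).
  move=> k; rewrite compnE leNgt => kn; apply/negP => kn'.
  by apply: Hk; exists n, k; rewrite leq_maxr.
have [D D0 HD] := telescope_bound T n.
(* The two pieces add up to [|x| <= |x|/2 + (5/4) D |T x - x|]. *)
exists (5 / 2 * D) => x; rewrite scale1r.
set d := T x - x.
have dx : rnorm (iter n T x - x) <= D * rnorm d by rewrite iter_telescope.
have x1 : rnorm (m g x) <= 1 / 4 * rnorm x + D * rnorm d.
  have -> : m g x = m g (iter n T x) - m g (iter n T x - x).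
    by rewrite [X in _ - X]linearB/= opprB addrC subrK.
  apply: (le_trans (rnormB _ _)); apply: lerD; last exact: le_trans (act_norm_le _ g1) dx.
  apply: (le_trans (iterT_small (c := r ^+ n) _ _ (HC n x).1)).
  - by rewrite exprn_ge0// ltW.
  - by move=> k; rewrite mulrC.
  by rewrite mulrCA -exprMn ler_wpM2r// rnorm_ge0.
have x2 : rnorm (m (1 - g) x) <= 1 / 4 * (rnorm x + D * rnorm d).
  (* Under [U^n] the function [1 - g] becomes its composite with [phi^n], which is [w_n] times that
     of [v]; and [w_n U^n = T^n]. *)
  have -> : m (1 - g) x = iter n V (m (compn phi n v) (iter n T x)).
    apply: (can_inj (iter_can n (su_UK S))); rewrite (iter_can n (su_VK S)).
    rewrite iter_com -vw iterT -(su_M S); congr (m _ _).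
    apply: CKP => k; rewrite -[RHS]/(compn phi n v k * coc w phi n k).
    rewrite !compnE -[LHS]/(v _ * compn psi n (coc w phi n) _) compnE.
    by rewrite (iter_can n (su_phiK S)).
  have v1' k : normc (compn phi n v k) <= r ^+ n.
    by rewrite compnE; have := v1 (iter n phi k); rewrite invrK.
  have [_ H] := @rateU r e C n (iter n T x) (m (compn phi n v) (iter n T x))
    r0 e0 C0 (su_norm S _ (exprn_ge0 _ (ltW r0)) v1') HC.
  apply: (le_trans H); apply: ler_pM CHN _; rewrite ?rnorm_ge0//.
    by rewrite mulr_ge0// ?exprn_ge0// ?mulr_ge0// ltW.
  by rewrite addrC (le_trans (rnorm_sub _ x))// lerD2r.
have := rnormD (m g x) (m (1 - g) x); rewrite -act_split.
have := rnorm_ge0 d; have := rnorm_ge0 x; move: x1 x2.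
set a := rnorm x; set b := rnorm d; set p := D * b; rewrite -(mulrA (5 / 2)) -/p.
lra.
Qed.

(** Completeness in the form consumed by the iteration below: a single index makes both the distance
    to the limit and the geometric bound small. *)
Definition geometrically_complete := forall (u : nat -> X) (C : R),
  (forall n, rnorm (u n.+1 - u n) <= C * 2^-1 ^+ n) ->
  exists l, forall e, 0 < e -> exists n, rnorm (u n - l) <= e /\ C * 2^-1 ^+ n <= e.

(** Successive correction: the residual [r n] is at least halved at each step, so the corrections
    [g (r n)] are summable and their sum is an exact solution. *)
Lemma approx_surjective A (B : R) : geometrically_complete ->
  (forall y, exists z, rnorm (y - A z) <= 2^-1 * rnorm y /\ rnorm z <= B * rnorm y) -> forall y, exists z, A z = y.
Proof.
move=> cX /choice[g Hg] y.
pose r n := iter n (fun y => y - A (g y)) y.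
have rS n : r n.+1 = r n - A (g (r n)) by [].
have rn n : rnorm (r n) <= 2^-1 ^+ n * rnorm y.
  elim: n => [|n IH]; first by rewrite mul1r.
  rewrite rS (le_trans (Hg _).1)// exprS -mulrA ler_wpM2l// invr_ge0//.
pose u n := \sum_(i < n) g (r i).
have Au n : y - A (u n) = r n.
  elim: n => [|n IH]; first by rewrite /u big_ord0 linear0 subr0.
  by rewrite /u big_ord_recr/= linearD/= opprD addrA IH -rS.
(* [B'] dominates both the increments of [u] and the residuals, so the index supplied by
   completeness serves for both; [B] itself may be negative. *)
pose B' := Num.max (Num.max B 0 * rnorm y) (rnorm y).
have [|l Hl] := cX u B'.
  move=> n; rewrite /u big_ord_recr/= [_ + g _]addrC addrK (le_trans (Hg _).2)//.
  apply: (@le_trans _ _ (Num.max B 0 * rnorm y * 2^-1 ^+ n)); last first.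
    by rewrite ler_wpM2r ?exprn_ge0 ?invr_ge0// le_max lexx.
  rewrite -mulrA [rnorm y * _]mulrC.
  apply: (@le_trans _ _ (Num.max B 0 * rnorm (r n))).
    by rewrite ler_wpM2r ?rnorm_ge0// le_max lexx.
  by rewrite ler_wpM2l ?rn// le_max lexx orbT.
exists l; apply/eqP; rewrite -subr_eq0; apply/eqP/rnorm0_eq0/eqP.
rewrite eq_le rnorm_ge0 andbT leNgt; apply/negP => d0.
have [c c0 Ac] := L_bound A.
set d := rnorm _ in d0.
(* Since [|A l - y| <= c |u n - l| + |r n|], this tolerance yields [d <= d/2]. *)
have [|n [un Bn]] := Hl (d / (2 * (c + 1))).
  by rewrite divr_gt0// mulr_gt0// ltr_wpDl.
have : d <= c * rnorm (u n - l) + rnorm (r n).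
  rewrite /d (_ : A l - y = - (A (u n - l) + r n)); last first.
    by rewrite -Au linearB/= opprD !opprB addrA subrK.
  by rewrite rnormN (le_trans (rnormD _ _))// lerD2r.
have rnB : rnorm (r n) <= B' * 2^-1 ^+ n.
  by rewrite (le_trans (rn n))// mulrC ler_wpM2r ?exprn_ge0 ?invr_ge0// le_max lexx orbT.
have /(le_trans rnB) rn' := Bn.
have cun := ler_wpM2l c0 un.
move=> H; have : d <= (c + 1) * (d / (2 * (c + 1))).
  by rewrite mulrDl mul1r (le_trans H)// lerD.
have c1 : c + 1 != 0 by rewrite gt_eqF// ltr_wpDl.
rewrite (_ : (c + 1) * (d / (2 * (c + 1))) = d / 2); first by lra.
by field.
Qed.

(** With [y1 = g y] and [T^n z' = (1 - g) y], the sum of [T^i (z' - y1)] over [i < n] solves the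
    equation up to the residual [T^n y1 + z']. Its norm is at most [|y|/2], because [T^n] contracts
    the first piece and expands [z'] onto the second. *)
Lemma surjective_of_not_colocalized : geometrically_complete ->
  ~ colocalized_orbits w phi psi -> forall y, exists z, T z - z = y.
Proof.
move=> cX /existsNP[r /existsNP[N0 /not_implyP[r01 Hk]]].
have [|e [C [N [e1 C0 HC HN]]]] := @rate_choice r (1/4) r01; first by lra.
have /andP[r0 r1] := r01.
have e0 : 0 < e by apply: lt_trans e1.
pose n := maxn N N0; have CHN := HN n (leq_maxl _ _).
have rn0 : 0 < r ^- n by rewrite invr_gt0 exprn_gt0.
have [|g [v [g1 gw vw v1]]] := @threshold_split (coc w phi n)
  (compn psi n (coc w phi n)) _ _ rn0 (exprn_ge0 n (ltW r0)).
  move=> k kn; rewrite compnE leNgt; apply/negP => kn'.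
  by apply: Hk; exists n, k; rewrite leq_maxr.
have [D D0 HD] := telescope_bound T n.
suff : forall y, exists z, (T - (idfun : 'L(X, X))) z = y by [].
apply: (@approx_surjective _ (5 / 4 * D) cX) => y.
pose y1 := m g y; pose z' := iter n V (m v y).
have Tz' : iter n T z' = m (1 - g) y.
  by rewrite iterT (iter_can n (su_VK S)) -vw mulrC (su_M S).
have z'y : rnorm z' <= 1 / 4 * rnorm y.
  have vy : rnorm (m v y) <= r ^+ n * rnorm y.
    apply: (su_norm S); first exact: exprn_ge0 (ltW r0).
    by move=> k; rewrite -[leRHS]invrK.
  by rewrite (le_trans (rateU r0 e0 C0 vy HC).2)// ler_wpM2r ?rnorm_ge0.
have Ty1 : rnorm (iter n T y1) <= 1 / 4 * rnorm y.
  rewrite iterT_com.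
  apply: (le_trans (iterT_small (c := r ^+ n) _ _ (HC n y).1)).
  - by rewrite exprn_ge0// ltW.
  - move=> k; rewrite compnE mulrC; have := gw (iter n phi k).
    by rewrite compnE (iter_can n (su_phiK S)).
  by rewrite mulrCA -exprMn ler_wpM2r// rnorm_ge0.
have y1y : rnorm y1 <= rnorm y := act_norm_le _ g1.
exists (\sum_(i < n) iter i T (z' - y1)); split; last first.
  rewrite (le_trans (HD _))// [leRHS]mulrAC [leRHS]mulrC ler_wpM2l//.
  by apply: (le_trans (rnormB _ _)); lra.
rewrite -[X in _ - X]/(T _ - _) telescope_right L_iterB Tz'.
rewrite [X in X - _](act_split g) -/y1.
rewrite (_ : _ - _ = iter n T y1 + z'); last first.
  by rewrite !opprB addrACA [y1 + _]addrC subrK [X in _ + X]addrC subrK addrC.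
by apply: (le_trans (rnormD _ _)); lra.
Qed.
End weighted_operator.

(** * Towers over nonperiodic points *)

Section orbit_distance.
Variables (K : compactHausdorffType) (phi psi : continuousType K K).
Hypotheses (phiK : cancel phi psi) (psiK : cancel psi phi).
Hypothesis ed : extremally_disconnected K.
Hypothesis aper : forall k : K, ~ periodic_point phi k.

(** Induction on [N]: a clopen [B] contains [k] but not [phi^(N+1) k], and the set is cut down to
    the points of [B] that [phi^(N+1)] sends outside [B]. *)
Lemma aperiodic_clopen (O : set K) k N : open O -> O k -> exists A : set K,
  [/\ clopen A, A k, A `<=` closure O &
    forall i j, (0 < i <= N)%N -> A j -> ~ A (iter i phi j)].
Proof.
move=> oO Ok; elim: N => [|N [A [cA Ak AO HA]]].
  exists (closure O); split=> //; first exact: clopen_closure.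
    exact: subset_closure.
  by move=> [|i].
have [|B [cB Bk nB]] := @clopen_separation K ed k (iter N.+1 phi k).
  by move=> kN; apply: (@aper k); exists N.+1.
exists (A `&` (B `&` (iter N.+1 phi @^-1` ~` B))); split.
- apply: clopenI => //; apply: clopenI => //.
  by apply: preimage_clopen; [exact: (clopenC set0)|exact: iter_cont].
- by [].
- by move=> j [/AO].
move=> i j /andP[i0]; rewrite leq_eqVlt => /orP[/eqP->|iN].
  by move=> [_ [_ nBj]] [_ [/nBj]].
by move=> [Aj _] [Ai _]; apply: (HA i j) => //; rewrite i0.
Qed.

Lemma find_iota (P : pred nat) M : let t := find P (iota 0 M) in
  [/\ (t <= M)%N, forall n, (n < M)%N -> P n -> (t <= n)%N &
    (t < M)%N -> P t].
Proof.
split.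
- by rewrite -[X in (_ <= X)%N](size_iota 0 M) find_size.
- move=> n nM Pn; rewrite leqNgt; apply/negP => nt.
  by have := before_find 0 nt; rewrite nth_iota// add0n Pn.
move=> tM; have hP : has P (iota 0 M) by rewrite has_find size_iota.
by have := nth_find 0 hP; rewrite nth_iota.
Qed.

Variables (A : set K) (M : nat).
Hypotheses (cA : clopen A) (M0 : (0 < M)%N).
Hypothesis HA : forall i j, (0 < i <= M.*2)%N -> A j -> ~ A (iter i phi j).

(** [find] returns the length [M] of the list when no [n < M] succeeds, which is the truncation at
    [M]. *)
Definition orbit_dist k :=
  find (fun n => (iter n phi k \in A) || (iter n psi k \in A)) (iota 0 M).

(** Finitely many clopen conditions decide the distance; being locally constant, it makes every
    function of it continuous. *)
Lemma orbit_dist_near k : \forall k' \near k, orbit_dist k' = orbit_dist k.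
Proof.
have H (f : continuousType K K) n :
    \forall k' \near k, (iter n f k' \in A) = (iter n f k \in A).
  have cP : clopen (iter n f @^-1` A) by apply: preimage_clopen => //; exact: iter_cont.
  near=> k'; have [H1 H2] : A (iter n f k') <-> A (iter n f k).
    by near: k'; exact: clopen_near.
  by apply/idP/idP; rewrite !inE.
have HN N : \forall k' \near k, forall n, (n < N)%N ->
    (iter n phi k' \in A) || (iter n psi k' \in A) =
    (iter n phi k \in A) || (iter n psi k \in A).
  elim: N => [|N IH]; first by near=> k'.
  near=> k' => n; rewrite ltnS leq_eqVlt => /orP[/eqP->|].
    by congr (_ || _); near: k'; exact: H.
  by move: n; near: k'.
near=> k'; rewrite /orbit_dist; apply: eq_in_find => n.
rewrite mem_iota add0n => /andP[_]; move: n; near: k'; exact: HN.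
Unshelve. all: by end_near. Qed.

Lemma orbit_distP k : [/\ (orbit_dist k <= M)%N,
   forall n, (n < M)%N -> A (iter n phi k) \/ A (iter n psi k) ->
     (orbit_dist k <= n)%N &
   (orbit_dist k < M)%N ->
   A (iter (orbit_dist k) phi k) \/ A (iter (orbit_dist k) psi k)].
Proof.
have [H1 H2 H3] := find_iota
  (fun n => (iter n phi k \in A) || (iter n psi k \in A)) M.
split=> // [n nM H|/H3/orP]; last by rewrite !inE.
by apply: H2 => //; apply/orP; rewrite !inE.
Qed.

Lemma orbit_dist0 k : A k -> orbit_dist k = 0%N.
Proof.
move=> Ak; have [_ H _] := orbit_distP k.
by apply/eqP; rewrite -leqn0 H//; left.
Qed.

(** One half of the Lipschitz bound along orbits; exchanging [phi] and [psi] through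
    [orbit_dist_sym] gives the other half. *)
Lemma orbit_dist_phi k : (orbit_dist (phi k) <= (orbit_dist k).+1)%N.
Proof.
have [H1 _ H3] := orbit_distP k; have [H1' H2' _] := orbit_distP (phi k).
have [/H3 H|Mk] := ltnP (orbit_dist k) M; last exact: leq_trans H1' (leqW Mk).
have up : A (iter (orbit_dist k).+1 psi (phi k)) ->
    (orbit_dist (phi k) <= (orbit_dist k).+1)%N.
  move=> Ak; have [?|] := ltnP (orbit_dist k).+1 M; last exact: leq_trans.
  by apply: H2' => //; right.
case: H => H; last by apply: up; rewrite iterSr phiK.
case E : (orbit_dist k) H => [|n] H.
  by rewrite -E; apply: up; rewrite E /= phiK.
apply: (@leq_trans n); last exact: leqW.
by apply: H2'; [rewrite -ltnS -E|left; rewrite -iterSr].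
Qed.

Lemma iter_sub (f g : K -> K) n N k : cancel f g -> (n <= N)%N ->
  iter n g (iter N f k) = iter (N - n) f k.
Proof.
by move=> fK nN; rewrite -{1}(subnKC nN) iterD (iter_can n fK).
Qed.

Lemma clopen_aperiodic_psi i j : (0 < i <= M.*2)%N -> A j -> ~ A (iter i psi j).
Proof.
by move=> iM Aj /(HA iM); rewrite (iter_can i psiK).
Qed.

End orbit_distance.

Lemma orbit_dist_sym (K : compactHausdorffType) (phi psi : continuousType K K)
  (A : set K) M k : orbit_dist phi psi A M k = orbit_dist psi phi A M k.
Proof. by apply: eq_find => n; rewrite orbC. Qed.

(** A distance [n < M] would put [phi^(M+n) k] or [phi^(M-n) k] in [A], and both exponents lie
    between 1 and [2M]; hence the range [M.*2] in the disjointness condition. *)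
Lemma orbit_dist_far (K : compactHausdorffType) (phi psi : continuousType K K)
    (A : set K) M k : cancel phi psi ->
  (forall i j, (0 < i <= M.*2)%N -> A j -> ~ A (iter i phi j)) ->
  A k -> orbit_dist phi psi A M (iter M phi k) = M.
Proof.
move=> phiK HA Ak; set k' := iter M phi k.
have [H1 _ H3] := orbit_distP phi psi A M k'.
apply/eqP; rewrite eqn_leq H1 leqNgt; apply/negP => H.
have [] := H3 H; rewrite /k'; set n := orbit_dist _ _ _ _ _ in H *.
  rewrite -iterD; apply: HA => //.
  by rewrite -addnn leq_add2r (ltnW H) andbT addn_gt0 (leq_ltn_trans _ H) ?orbT.
rewrite (iter_sub _ phiK (ltnW H)).
apply: HA => //; rewrite subn_gt0 H -addnn.
by rewrite (leq_trans (leq_subr _ _))// leq_addr.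
Qed.

(** * Disjoint clopen translates with slowly varying weights *)

Section tower.
Variables (R : realType) (K : compactHausdorffType) (X : normedModType R[i]).
Variables (m : CK R K -> 'L(X, X)) (U V : 'L(X, X)).
Variables (phi psi : continuousType K K).
Hypothesis S : weighted_setup m U V phi psi.

(* The intended e is the indicator of a clopen set A whose translates by phi^i,
   |i| <= M, are disjoint; d = s ^ dist where dist k is the distance from k to A
   along its orbit, truncated at M; and b = 1 / d. *)
Record tower (O : set K) M (s : R) (e d b : CK R K) : Prop := {
  tw_supp : forall k, e k != 0 -> O k;
  tw_ee : e * e = e;
  tw_nz : exists x, m e x <> 0;
  tw_disj : forall i k, (0 < i <= M.*2)%N -> e k * e (iter i phi k) = 0;
  tw_bd : b * d = 1;
  tw_ed : e * d = e;
  tw_slow : forall k, normc (b k * d (phi k) - 1) <= s^-1 - 1;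
  tw_phi : forall k, normc (compn phi M e k * d k) <= s ^+ M;
  tw_psi : forall k, normc (compn psi M e k * d k) <= s ^+ M
}.

(** The ratio is 1, [s^-1] or [s], and [1 - s <= s^-1 - 1]. *)
Lemma slow_ratio (s : R) a b : 0 < s < 1 -> (a <= b.+1)%N -> (b <= a.+1)%N ->
  `|s ^- a * s ^+ b - 1| <= s^-1 - 1.
Proof.
move=> /andP[s0 s1] ab ba.
have sX n : s ^+ n != 0 by rewrite expf_neq0// gt_eqF.
have s1V : 1 < s^-1 by rewrite invf_gt1.
have [->|nab] := eqVneq a b.
  by rewrite mulVf// subrr normr0 subr_ge0 ltW.
have [ltab|] := ltnP b a.
  have -> : a = b.+1 by apply/eqP; rewrite eqn_leq ab.
  by rewrite exprS invfM mulfVK// ger0_norm// subr_ge0 ltW.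
rewrite leq_eqVlt (negbTE nab)/= => ltab.
have -> : b = a.+1 by apply/eqP; rewrite eqn_leq ba.
rewrite exprSr mulKf// ler0_norm ?subr_le0 ?ltW//.
have := mulr_gt0 s0 (lt_trans ltr01 s1V).
have : s * s^-1 = 1 by rewrite divff// gt_eqF.
by move: s1V; set t := s^-1 => *; nra.
Qed.

Lemma tower_exists (O : set K) k M (s : R) : (0 < M)%N -> 0 < s < 1 ->
  open O -> O k -> exists e d b, tower (closure O) M s e d b.
Proof.
move=> M0 s01 oO Ok; have /andP[s0 s1] := s01.
have [A [cA Ak AO HA]] :=
  aperiodic_clopen (su_extr S) (su_aper S) M.*2 oO Ok.
have HA' := clopen_aperiodic_psi (su_psiK S) HA.
have [e eE] := @clopen_indicator R K A cA.
pose t := orbit_dist phi psi A M.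
have /choice[F FE] : forall g : nat -> R[i],
    exists f : CK R K, forall k, f k = g (t k).
  move=> g; suff cg : continuous (fun k => g (t k)) by exists (mkCK cg).
  move=> k'; apply: (@near_cst_continuous _ _ (g (t k'))).
  have tk' : \forall k'' \near k', t k'' = t k' := orbit_dist_near phi psi M cA k'.
  by near=> k''; congr (g _); near: k''.
exists e, (F (fun n => (s ^+ n)%:C%C)), (F (fun n => (s ^- n)%:C%C)).
have sX n : s ^+ n != 0 by rewrite expf_neq0// gt_eqF.
have sX0 n : 0 <= s ^+ n by rewrite exprn_ge0// ltW.
have ee k' : e k' * e k' = e k'.
  by rewrite eE; case: (k' \in A); rewrite ?mulr1 ?mulr0.
have e01 k' : normc (e k') <= 1 by rewrite eE; exact: normc_indicator.
split.
- move=> k'; rewrite eE; case: (boolP (k' \in A)) => [|_]; last by rewrite eqxx.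
  by rewrite inE => /AO.
- exact: CKP.
- apply/not_existsP => H.
  have /(congr1 (fun f : CK R K => f k)) : e = 0.
    by apply: (su_inj S) => x; apply: contrapT; exact: H.
  by rewrite eE mem_set// => /eqP; rewrite oner_eq0.
- move=> i k' iM; rewrite !eE.
  have [kA|kA] := pselect (A k'); last by rewrite memNset// mul0r.
  by rewrite [iter i phi k' \in A]memNset ?mulr0//; exact: HA.
- by apply: CKP => k'; rewrite -[LHS]/(F _ k' * F _ k') !FE -rmorphM/= mulVf.
- apply: CKP => k'; rewrite -[LHS]/(e k' * F _ k') FE eE.
  have [kA|kA] := pselect (A k'); last by rewrite memNset// mul0r.
  by rewrite mem_set// mul1r /t orbit_dist0.
- move=> k'; rewrite (_ : _ - 1 =
      ((s ^- t k' * s ^+ t (phi k') - 1)%:C)%C); last first.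
    by rewrite !FE rmorphB rmorphM.
  rewrite normc_real slow_ratio//.
    rewrite /t -{1}[k'](su_phiK S) !(orbit_dist_sym phi).
    exact: (@orbit_dist_phi K psi phi (su_psiK S)).
  exact: (@orbit_dist_phi K phi psi (su_phiK S)).
- move=> k'; rewrite compnE FE normcM normc_real ger0_norm//.
  have [kA|kA] := pselect (A (iter M phi k')); last first.
    by rewrite eE memNset// normc0 mul0r.
  (* Such a [k'] is [psi^M] of a point of [A], hence at distance exactly [M]. *)
  have -> : t k' = M.
    rewrite -[k'](iter_can M (su_phiK S)) /t orbit_dist_sym.
    exact: (orbit_dist_far (su_psiK S)).
  by rewrite -[leRHS]mul1r ler_wpM2r.
move=> k'; rewrite compnE FE normcM normc_real ger0_norm//.
have [kA|kA] := pselect (A (iter M psi k')); last first.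
  by rewrite eE memNset// normc0 mul0r.
have -> : t k' = M.
  rewrite -[k'](iter_can M (su_psiK S)) /t.
  exact: (orbit_dist_far (su_phiK S)).
by rewrite -[leRHS]mul1r ler_wpM2r.
Unshelve. all: by end_near. Qed.

End tower.

(** * Approximate eigenvectors on towers *)

Section obstructions.
Variables (R : realType) (K : compactHausdorffType) (X : normedModType R[i]).
Variables (m : CK R K -> 'L(X, X)) (U V : 'L(X, X)).
Variables (phi psi : continuousType K K).
Hypothesis S : weighted_setup m U V phi psi.
Variable w : CK R K.
Let T : 'L(X, X) := m w \o U.

Lemma compnM (chi : continuousType K K) n (f g : CK R K) :
  compn chi n (f * g) = compn chi n f * compn chi n g.
Proof.
by apply: CKP => k; rewrite -[RHS]/(compn chi n f k * compn chi n g k) !compnE.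
Qed.

Lemma compn_phiK n (f : CK R K) : compn phi n (compn psi n f) = f.
Proof. by apply: CKP => k; rewrite !compnE (iter_can n (su_phiK S)). Qed.

Lemma compn_psiK n (f : CK R K) : compn psi n (compn phi n f) = f.
Proof. by apply: CKP => k; rewrite !compnE (iter_can n (su_psiK S)). Qed.

Lemma iterV_com n f x : iter n V (m f x) = m (compn psi n f) (iter n V x).
Proof.
apply: (can_inj (iter_can n (su_UK S))).
by rewrite (iter_com S) !(iter_can n (su_VK S)) compn_phiK.
Qed.

Lemma compnC i j (f : CK R K) :
  compn phi i (compn psi j f) = compn psi j (compn phi i f).
Proof.
have comm n n' h : compn phi n (compn phi n' h) = compn phi n' (compn phi n h).
  by rewrite /compn -!iterD addnC.
by rewrite -[in RHS](compn_phiK j f) comm compn_psiK.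
Qed.

Section in_tower.
Variables (O : set K) (M : nat) (s : R) (e d b : CK R K).
Hypothesis tw : tower m phi psi O M s e d b.
Hypothesis s01 : 0 < s < 1.

Lemma tw_e01 k : e k = 0 \/ e k = 1.
Proof.
have := congr1 (fun f : CK R K => f k) (tw_ee tw).
rewrite -[(e * e) k]/(e k * e k) => /eqP; rewrite -subr_eq0 -[X in _ - X]mulr1.
by rewrite -mulrBr mulf_eq0 subr_eq0 => /orP[]/eqP; [left|right].
Qed.

Lemma tw_e1 k : normc (e k) <= 1.
Proof. by case: (tw_e01 k) => ->; rewrite ?normc1 ?normc0. Qed.

Lemma tw_be : b * e = e.
Proof. by rewrite -[in LHS](tw_ed tw) mulrCA (tw_bd tw) mulr1. Qed.

Lemma tw_bound (f : CK R K) (r : R) : 0 <= r ->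
  (forall k, O k -> normc (f k) <= r) -> forall k, normc (f k * e k) <= r.
Proof.
move=> r0 fO k; case: (tw_e01 k) => ek; first by rewrite ek mulr0 normc0.
by rewrite ek mulr1; apply: fO; apply: (tw_supp tw); rewrite ek oner_eq0.
Qed.

(** Passing from [d] to its composite with [phi] costs a factor at most [s^-1], because [b] times
    that composite is within [s^-1 - 1] of 1. *)
Lemma tw_next (f : CK R K) : (forall k, normc (f k * d k) <= s ^+ M) ->
  forall k, normc (f k * CK_comp d phi k) <= s^-1 * s ^+ M.
Proof.
move=> fd k; have -> : f k * CK_comp d phi k = b k * d (phi k) * (f k * d k).
  have /(congr1 (fun f : CK R K => f k)) := tw_bd tw.
  rewrite -[(b * d) k]/(b k * d k) -[X in _ = X]/1 => bd.
  transitivity (b k * d k * (f k * d (phi k))); first by rewrite bd mul1r.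
  by ring.
have /andP[s0 s1] := s01.
rewrite normcM ler_pM ?normc_ge0//.
rewrite -(subrK 1 (_ * d _)) (le_trans (le_normcD _ _))// normc1.
by rewrite -lerBrDr (tw_slow tw).
Qed.

Lemma tw_shift i j : (i <= M.*2)%N -> (j <= M.*2)%N -> i != j ->
  compn phi i e * compn phi j e = 0.
Proof.
wlog ij : i j / (i < j)%N => [H|iM jM _].
  move=> iM jM; rewrite neq_ltn => /orP[] ij; first by apply: H; rewrite ?ltn_eqF.
  by rewrite mulrC; apply: H => //; rewrite ltn_eqF.
apply: CKP => k; rewrite -[LHS]/(compn phi i e k * compn phi j e k) !compnE.
rewrite -(subnK (ltnW ij)) iterD (tw_disj tw)// subn_gt0 ij.
by rewrite (leq_trans (leq_subr _ _)).
Qed.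

(** [e] takes only the values 0 and 1, so its support is given by a strict and by a weak inequality
    at 1/2; it is therefore clopen and [f] can be inverted on it. *)
Lemma tw_inverse (f : CK R K) (r : R) : 0 < r ->
  (forall k, O k -> r <= normc (f k)) ->
  exists v, [/\ v * f = e, v * e = v & forall k, normc (v k) <= r^-1].
Proof.
move=> r0 fO.
have cA : clopen [set k | e k != 0].
  have -> : [set k | e k != 0] = [set k | 1 / 2 < normc (e k)].
    apply/seteqP; split=> k /=; case: (tw_e01 k) => ->; rewrite ?eqxx ?normc0 ?normc1//; lra.
  split; first exact: open_normc_gt.
  rewrite (_ : [set k | _] = [set k | 1 / 2 <= normc (e k)]).
    exact: closed_normc_ge.
  by apply/seteqP; split=> k /=; case: (tw_e01 k) => ->; rewrite ?normc0 ?normc1//; lra.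
have fA k : e k != 0 -> f k != 0.
  move=> /(tw_supp tw)/fO; apply: contraTneq => ->; rewrite normc0 -ltNge//.
have [v vE] := @clopen_inverse R K f _ cA fA.
exists v; split=> [||k].
- apply: CKP => k; rewrite -[LHS]/(v k * f k) vE.
  case: ifPn => [|/negP]; rewrite in_setE/= => ek.
    by rewrite mulVf ?fA//; case: (tw_e01 k) ek => ->; rewrite ?eqxx.
  by rewrite mul0r; apply/esym/eqP/negPn/negP.
- apply: CKP => k; rewrite -[LHS]/(v k * e k) vE.
  case: ifPn => [|_]; last by rewrite mul0r.
  by rewrite in_setE/=; case: (tw_e01 k) => ->; rewrite ?eqxx ?mulr1.
rewrite vE; case: ifPn => [|_]; last by rewrite normc0 invr_ge0 ltW.
rewrite in_setE/= => /(tw_supp tw)/fO H.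
by rewrite normcV lef_pV2// posrE (lt_le_trans r0).
Qed.

End in_tower.

(** The vector [z] is the weighted sum of the layers [T^j q], [j < 2M], whose layer [j = M] is [y].
    In [T z - z] there remain the variation of the weight and the two ends of the tower, where the
    weight of order [s^M] beats the cocycle bound [p^-M] and the growth of [U]. *)
Lemma not_bounded_below_of_localized :
  localized_orbits w phi psi -> ~ bounded_below T 1.
Proof.
move=> loc [c0 Hc0].
pose c : R := `|c0| + 1; have cp : 0 < c by rewrite ltr_wpDl.
have Hc x : rnorm x <= c * rnorm (T x - x).
  apply: (le_trans (Hc0 x)); rewrite scale1r ler_wpM2r ?rnorm_ge0// /c.
  by rewrite (le_trans (ler_norm _))// lerDl.
(* Chosen so that the relative variation [s^-1 - 1] of the weight is [1/(4c)]. *)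
pose s := 4 * c / (4 * c + 1).
have c41 : 0 < 4 * c + 1 by lra.
have s0 : 0 < s by rewrite divr_gt0// mulr_gt0.
have s1 : s < 1 by rewrite ltr_pdivrMr//; lra.
have sV : s^-1 - 1 = (4 * c)^-1.
  by rewrite /s; field; rewrite !gt_eqF.
have s01 : 0 < s < 1 by rewrite s0.
(* [p] lies strictly between [s] and 1, so the ends are damped by [(s/p)^M], which still decays
   after the growth of [U] is absorbed. *)
pose p := (s + 1) / 2.
have p0 : 0 < p by rewrite /p; lra.
have p01 : 0 < p < 1 by rewrite p0 /p; lra.
have q01 : 0 < s / p < 1 by rewrite divr_gt0//= ltr_pdivrMr// /p; lra.
clearbody p s; have [|E [C [N [E1 C0 HC HN]]]] := rate_choice S q01 (_ : 0 < s / (8 * c)).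
  by rewrite divr_gt0// mulr_gt0.
have E0 : 0 < E by apply: lt_trans E1.
have [M [k [NM kM1 kM2]]] := loc p N.+1 p01.
have CHN := HN M (ltnW NM).
have M0 : (0 < M)%N by apply: leq_trans NM.
pose O := [set k | p ^+ M < normc (coc w phi M k)] `&`
  [set k | normc (compn psi M (coc w phi M) k) < p ^- M].
have oO : open O by apply: openI; [exact: open_normc_gt|exact: open_normc_lt].
have Ok : O k by split=> //=; rewrite compnE.
have [e [d [b tw]]] := tower_exists S M0 s01 oO Ok.
(* The tower lives over the closure of [O], where the strict inequalities persist as weak ones. *)
have O1 : forall k', closure O k' -> p ^+ M <= normc (coc w phi M k').
  by apply: closure_sub_closed; [exact: closed_normc_ge|move=> k' [/ltW]].
have O2 : forall k', closure O k' ->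
    normc (compn psi M (coc w phi M) k') <= p ^- M.
  by apply: closure_sub_closed; [exact: closed_normc_le|move=> k' [_ /ltW]].
have pM0 : 0 < p ^+ M by rewrite exprn_gt0.
have pMV0 : 0 < p ^- M by rewrite invr_gt0.
have [v [vw ve v1]] := tw_inverse tw pM0 O1.
have [x0 mx0] := tw_nz tw.
pose y := m e x0.
have ey : m e y = y by rewrite /y -(su_M S) (tw_ee tw).
pose q := iter M V (m v y).
have TMq : iter M T q = y.
  by rewrite (iterT S) (iter_can M (su_VK S)) -(su_M S) mulrC vw.
have eq : m (compn psi M e) q = q by rewrite /q -iterV_com -(su_M S) mulrC ve.
pose sg := \sum_(j < M.*2) iter j T q.
pose z := m d sg.
pose dp := CK_comp d phi.
have TD f x : T (m f x) = m (CK_comp f phi) (T x) := iterT_com S w 1 f x.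
have Tsg : T sg - sg = iter M T y - q.
  by rewrite /sg telescope_right -TMq -iterD addnn.
(* Discrete product rule: the first term is the variation of the weight, the other two are the ends
   left by telescoping. *)
have Tz : T z - z = m (b * dp - 1) z + m dp (iter M T y) - m dp q.
  rewrite -addrA -[m dp _ - _]linearB/= -Tsg linearB/= -TD.
  rewrite addrCA; congr (_ + _); rewrite (act_subr S) (su_1 S) addrAC.
  by rewrite /z -(su_M S) mulrAC (tw_bd tw) mul1r subrr add0r.
have qMV : rnorm q <= C * (p^-1 * E) ^+ M * rnorm y.
  have vy : rnorm (m v y) <= p^-1 ^+ M * rnorm y.
    by apply: (su_norm S) => [|k']; rewrite exprVn ?v1// ltW.
  have pi0 : 0 < p^-1 by rewrite invr_gt0.
  exact: (rateU pi0 E0 C0 vy HC).2.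
have rate : s^-1 * s ^+ M * (C * (p^-1 * E) ^+ M) = s^-1 * (C * (s / p * E) ^+ M).
  by rewrite !exprMn; ring.
have q2 : rnorm (m dp q) <= s^-1 * (s / (8 * c)) * rnorm y.
  rewrite -[in X in rnorm X <= _]eq -(su_M S).
  apply: (le_trans (su_norm S (c := s^-1 * s ^+ M) _ _ _)).
  - by rewrite mulr_ge0// ?invr_ge0 ?exprn_ge0// ltW.
  - move=> k'; rewrite mulrC; exact: (tw_next tw s01 (tw_psi tw)).
  apply: (@le_trans _ _ (s^-1 * (C * (s / p * E) ^+ M) * rnorm y)).
    rewrite -rate -[leRHS]mulrA ler_wpM2l//.
    by rewrite mulr_ge0// ?invr_ge0 ?exprn_ge0// ltW.
  by rewrite ler_wpM2r ?rnorm_ge0// ler_wpM2l ?CHN// invr_ge0 ltW.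
have q1 : rnorm (m dp (iter M T y)) <= s^-1 * (s / (8 * c)) * rnorm y.
  have -> : iter M T y = m (compn phi M e) (iter M T y) by rewrite -(iterT_com S) ey.
  rewrite -(su_M S).
  apply: (le_trans (iterT_small S (c := p ^- M * (s^-1 * s ^+ M)) _ _ (HC M y).1)).
  - by rewrite !mulr_ge0// ?invr_ge0 ?exprn_ge0// ltW.
  (* The idempotent is used twice, once to bound the cocycle and once to bound the weight. *)
  - move=> k'; have -> : coc w phi M k' * (dp * compn phi M e) k' =
        coc w phi M k' * compn phi M e k' * (compn phi M e k' * dp k').
      rewrite -[(dp * _) k']/(dp k' * _ k').
      have : compn phi M e k' * compn phi M e k' = compn phi M e k'.
        by rewrite compnE; case: (tw_e01 tw (iter M phi k')) => ->; rewrite ?mulr0 ?mulr1.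
      by move=> ee; rewrite -mulrA [X in _ = _ * X]mulrA ee [X in _ * X]mulrC.
    rewrite normcM ler_pM ?normc_ge0//.
      rewrite compnE; have := tw_bound tw (ltW pMV0) O2 (iter M phi k').
      by rewrite compnE (iter_can M (su_phiK S)).
    exact: (tw_next tw s01 (tw_phi tw)).
  rewrite ler_wpM2r ?rnorm_ge0//.
  apply: (@le_trans _ _ (s^-1 * (C * (s / p * E) ^+ M))).
    by rewrite -rate !exprMn !exprVn le_eqVlt; apply/orP; left; apply/eqP; ring.
  by rewrite ler_wpM2l ?CHN// invr_ge0 ltW.
have ez : m e z = y.
  rewrite /z -(su_M S) (tw_ed tw) /sg linear_sum/= -ey -TMq.
  have MM : (M < M.*2)%N by rewrite -addnn -addn1 leq_add2l.
  (* Only the layer [j = M] meets the support of [e]. *)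
  rewrite (bigD1 (Ordinal MM))//= big1 ?addr0// => j jM.
  rewrite -eq (iterT_com S) -(su_M S) compnC.
  rewrite (_ : e * _ = 0).
    by rewrite -(subrr (1 : CK R K)) (act_subr S) subrr.
  rewrite -{1}(compn_psiK M e) -compnM (tw_shift tw) ?(ltnW MM)//; last first.
  - by rewrite eq_sym.
  - by rewrite ltnW.
  by apply: CKP => k'; rewrite compnE.
have zy : rnorm y <= rnorm z by rewrite -ez (act_norm_le S)// => k'; exact: tw_e1 tw k'.
have z1 : rnorm (m (b * dp - 1) z) <= (4 * c)^-1 * rnorm z.
  rewrite -sV; apply: (su_norm S); last exact: (tw_slow tw).
  by rewrite sV invr_ge0 mulr_ge0// ltW.
have sc : s^-1 * (s / (8 * c)) = (8 * c)^-1 by rewrite mulrA mulVf ?mul1r// gt_eqF.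
have Tzb : c * rnorm (T z - z) <= 2^-1 * rnorm z.
  (* The variation contributes [1/(4c)] and each end [1/(8c)]. *)
  have : rnorm (T z - z) <= (2 * c)^-1 * rnorm z.
    rewrite Tz; apply: (le_trans (rnormB _ _)).
    have H1 := rnormD (m (b * dp - 1) z) (m dp (iter M T y)).
    rewrite sc in q1 q2.
    have H2 : (8 * c)^-1 * rnorm y <= (8 * c)^-1 * rnorm z.
      by rewrite ler_wpM2l// invr_ge0 mulr_ge0// ltW.
    have E1' : (2 * c)^-1 * rnorm z = (4 * c)^-1 * rnorm z + 2 * ((8 * c)^-1 * rnorm z).
      by field; rewrite gt_eqF.
    lra.
  move=> /(ler_wpM2l (ltW cp)); rewrite mulrA (_ : c * (2 * c)^-1 = 2^-1)//.
  by field; rewrite gt_eqF.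
have z0 : rnorm z = 0.
  have := Hc z; have := rnorm_ge0 z; lra.
by apply: mx0; apply: rnorm0_eq0; apply/eqP; rewrite eq_le rnorm_ge0 andbT -z0.
Qed.

End obstructions.

(** * Towers as an obstruction to surjectivity *)

Section surjective_obstruction.
Variables (R : realType) (K : compactHausdorffType) (X : normedModType R[i]).
Variables (m : CK R K -> 'L(X, X)) (U V : 'L(X, X)).
Variables (phi psi : continuousType K K).
Hypothesis S : weighted_setup m U V phi psi.
Variable w : CK R K.
Let T : 'L(X, X) := m w \o U.

Lemma act_0 x : m 0 x = 0.
Proof. by rewrite -(subrr (1 : CK R K)) (act_subr S) subrr. Qed.

(** For a solution of [T z - z = y] with [y] in the base layer, the bound on [Z = b z] makes [z] of
    order [s^M] at both ends of the tower. Transporting the two ends to the base expresses both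
    [e z] and [e z + y] by negligible terms. *)
Lemma not_colocalized_of_invertible : bounded_below T 1 ->
  (forall y, exists z, T z - z = y) -> ~ colocalized_orbits w phi psi.
Proof.
move=> [c0 Hc0] sur loc.
pose c : R := `|c0| + 1; have cp : 0 < c by rewrite ltr_wpDl.
have Hc x : rnorm x <= c * rnorm (T x - x).
  apply: (le_trans (Hc0 x)); rewrite scale1r ler_wpM2r ?rnorm_ge0// /c.
  by rewrite (le_trans (ler_norm _))// lerDl.
clearbody c; have [t0 t00 Ht0] := L_bound T.
pose t := t0 + 1; have tp : 0 < t by rewrite ltr_wpDl.
have Ht x : rnorm (T x) <= t * rnorm x.
  by rewrite (le_trans (Ht0 x))// ler_wpM2r ?rnorm_ge0// lerDl.
(* With [s^-1 - 1 = 1/a], the weight error costs half of [|Z|] in [|Z| <= c |T Z - Z|] and can be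
   absorbed. *)
clearbody t; pose a := 2 * c * t; have ap : 0 < a by rewrite !mulr_gt0.
have aE : a = 2 * c * t by [].
clearbody a; pose s := a / (a + 1).
have a1 : 0 < a + 1 by lra.
have s0 : 0 < s by rewrite divr_gt0.
have s1 : s < 1 by rewrite ltr_pdivrMr//; lra.
have sV : s^-1 - 1 = a^-1 by rewrite /s; field; rewrite !gt_eqF.
have s01 : 0 < s < 1 by rewrite s0.
pose p := (s + 1) / 2.
have p0 : 0 < p by rewrite /p; lra.
have p01 : 0 < p < 1 by rewrite p0 /p; lra.
have q01 : 0 < s / p < 1 by rewrite divr_gt0//= ltr_pdivrMr// /p; lra.
clearbody p s; have [|E [C [N [E1 C0 HC HN]]]] := rate_choice S q01 (_ : 0 < (8 * c)^-1).
  by rewrite invr_gt0 mulr_gt0.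
have E0 : 0 < E by apply: lt_trans E1.
have [M [k [NM kM1 kM2]]] := loc p N.+1 p01.
have CHN := HN M (ltnW NM).
have M0 : (0 < M)%N by apply: leq_trans NM.
have MM : (M <= M.*2)%N by rewrite -addnn leq_addr.
pose O := [set k | normc (coc w phi M k) < p ^- M] `&`
  [set k | p ^+ M < normc (compn psi M (coc w phi M) k)].
have oO : open O by apply: openI; [exact: open_normc_lt|exact: open_normc_gt].
have Ok : O k by split=> //=; rewrite compnE.
have [e [d [b tw]]] := tower_exists S M0 s01 oO Ok.
have O1 : forall k', closure O k' -> normc (coc w phi M k') <= p ^- M.
  by apply: closure_sub_closed; [exact: closed_normc_le|move=> k' [/ltW]].
have O2 : forall k', closure O k' ->
    p ^+ M <= normc (compn psi M (coc w phi M) k').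
  by apply: closure_sub_closed; [exact: closed_normc_ge|move=> k' [_ /ltW]].
have pM0 : 0 < p ^+ M by rewrite exprn_gt0.
have pMV0 : 0 < p ^- M by rewrite invr_gt0.
have sX0 : 0 <= s ^+ M by rewrite exprn_ge0// ltW.
have [v [vw ve v1]] := tw_inverse tw pM0 O2.
have [x0 mx0] := tw_nz tw.
pose y := m e x0.
have ey : m e y = y by rewrite /y -(su_M S) (tw_ee tw).
have [z Tz] := sur y.
pose Z := m b z.
have dZ : m d Z = z by rewrite /Z -(su_M S) mulrC (tw_bd tw) (su_1 S).
pose dp := CK_comp d phi; pose bp := CK_comp b phi.
have bdp : dp * bp = 1.
  apply: CKP => k'; rewrite -[LHS]/(d (phi k') * b (phi k')) mulrC.
  exact: (congr1 (fun f : CK R K => f (phi k')) (tw_bd tw)).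
have TZ : T Z = m bp (T z) := iterT_com S w 1 b z.
have TZZ : T Z - Z = y - m (b * dp - 1) (T Z).
  have by_ : m b y = y by rewrite /y -(su_M S) (tw_be tw).
  rewrite (act_subr S) (su_1 S) TZ -[m (b * dp) _](su_M S) -mulrA bdp mulr1.
  have -> : m b (T z) = y + Z by rewrite -(subrK z (T z)) Tz linearD/= by_.
  by rewrite opprB opprD addrCA [y + _]addrA subrr add0r.
(* Combes-Thomas: Z = b z solves T Z - Z = y up to a small multiple of T Z. *)
have Zy : rnorm Z <= 2 * c * rnorm y.
  have H1 : rnorm (m (b * dp - 1) (T Z)) <= a^-1 * (t * rnorm Z).
    apply: (@le_trans _ _ (a^-1 * rnorm (T Z))).
      rewrite -sV; apply: (su_norm S); last exact: (tw_slow tw).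
      by rewrite sV invr_ge0 ltW.
    by rewrite ler_wpM2l// invr_ge0 ltW.
  have H2 := Hc Z; rewrite TZZ in H2.
  have H3 := ler_wpM2l (ltW cp) (rnormB y (m (b * dp - 1) (T Z))).
  have H4 : c * (a^-1 * (t * rnorm Z)) = 2^-1 * rnorm Z.
    by rewrite aE; field; rewrite !gt_eqF.
  have := ler_wpM2l (ltW cp) H1; rewrite H4 => H5.
  rewrite mulrDr in H3; rewrite -mulrA; lra.
have small (f : CK R K) : (forall k, normc (f k * d k) <= s ^+ M) ->
    rnorm (m f z) <= s ^+ M * rnorm Z.
  by move=> fd; rewrite -dZ -(su_M S) (su_norm S).
have TMz : iter M T z - z = \sum_(i < M) iter i T y.
  by rewrite iter_telescope Tz.
have disj i j : (i <= M)%N -> (j < M)%N -> i != j ->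
    m (compn phi i e) (iter j T y) = 0.
  move=> iM jM ij; rewrite -ey (iterT_com S) -(su_M S) (tw_shift tw) ?act_0//.
    exact: leq_trans MM.
  by rewrite (leq_trans (ltnW jM)).
(* No [T^i y] with [i < M] meets the layer over [phi^M], so [T^M z] and [z] agree there; [v] and [V]
   then undo [T^M]. *)
have back : m e z = iter M V (m (compn phi M v) (m (compn phi M e) z)).
  have H : m (compn phi M e) (iter M T z) = m (compn phi M e) z.
    apply/eqP; rewrite -subr_eq0 -linearB/= TMz linear_sum/= big1// => i _.
    by rewrite disj// gtn_eqF.
  apply: (can_inj (iter_can M (su_UK S))); rewrite (iter_can M (su_VK S)).
  rewrite (iter_com S) -H -(su_M S) -compnM ve (iterT S) -(su_M S).
  by rewrite -(compn_phiK S M (coc w phi M)) -compnM vw.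
(* In the base layer the term [i = 0] survives, whence the extra [y]. *)
have fwd : m e z = m e (iter M T (m (compn psi M e) z)) - y.
  rewrite (iterT_com S) (compn_phiK S) -(su_M S) (tw_ee tw).
  rewrite -[iter M T z](subrK z) TMz linearD/= linear_sum/=.
  rewrite (bigD1 (Ordinal M0))//= ey big1 ?addr0.
    by rewrite addrC addKr.
  by move=> i i0; apply: (disj 0%N) => //; rewrite eq_sym.
have rate : s ^+ M * (C * (p^-1 * E) ^+ M) = C * (s / p * E) ^+ M.
  by rewrite !exprMn; ring.
have y1 : rnorm (m e (iter M T (m (compn psi M e) z))) <=
    (8 * c)^-1 * rnorm Z.
  apply: (le_trans (iterT_small S (c := p ^- M) _ _ (HC M _).1)).
  - exact: ltW.
  - exact: (tw_bound tw (ltW pMV0) O1).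
  apply: (@le_trans _ _ (p ^- M * (C * E ^+ M) * (s ^+ M * rnorm Z))).
    rewrite ler_wpM2l ?small//; last exact: (tw_psi tw).
    by rewrite !mulr_ge0 ?exprn_ge0// ltW.
  rewrite mulrA ler_wpM2r ?rnorm_ge0// (le_trans _ CHN)// -rate.
  by rewrite exprMn exprVn le_eqVlt; apply/orP; left; apply/eqP; ring.
have y2 : rnorm (m e z) <= (8 * c)^-1 * rnorm Z.
  have vy : rnorm (m (compn phi M v) (m (compn phi M e) z)) <=
      (s / p) ^+ M * rnorm Z.
    apply: (@le_trans _ _ (p ^- M * rnorm (m (compn phi M e) z))).
      by apply: (su_norm S) => [|k']; rewrite ?compnE ?v1// ltW.
    rewrite exprMn exprVn [s ^+ M * _]mulrC -mulrA ler_wpM2l ?small//.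
      exact: ltW.
    exact: (tw_phi tw).
  have sp0 : 0 < s / p by rewrite divr_gt0.
  rewrite back (le_trans (rateU sp0 E0 C0 vy HC).2)//.
  by rewrite ler_wpM2r ?rnorm_ge0.
have : rnorm y <= 2^-1 * rnorm y.
  have yE : y = m e (iter M T (m (compn psi M e) z)) - m e z.
    by rewrite fwd opprB addrC subrK.
  rewrite [in X in X <= _]yE; apply: (le_trans (rnormB _ _)).
  have H : (8 * c)^-1 * rnorm Z <= 4^-1 * rnorm y.
    apply: (@le_trans _ _ ((8 * c)^-1 * (2 * c * rnorm y))).
      by rewrite ler_wpM2l// invr_ge0 mulr_ge0// ltW.
    by rewrite le_eqVlt; apply/orP; left; apply/eqP; field; rewrite gt_eqF.
  lra.
move=> yy; apply: mx0; apply: rnorm0_eq0; apply/eqP.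
by rewrite eq_le rnorm_ge0 andbT; rewrite -/y; lra.
Qed.

End surjective_obstruction.

(** * Growth of the powers of an operator *)

Section gelfand.
Variables (R : realType) (X : normedModType R[i]) (U : 'L(X, X)).

Hypothesis resolvent : forall z : R[i], normc z < 1 -> exists B : 'L(X, X),
  (forall x, B (x - z *: U x) = x) /\ (forall x, B x - z *: U (B x) = x).

Lemma L_iterZ n (a : R[i]) x : iter n U (a *: x) = a *: iter n U x.
Proof. by elim: n => //= n ->; rewrite linearZ. Qed.

Lemma normc_le_sum (x y : R) : normc (x +i* y)%C <= `|x| + `|y|.
Proof.
rewrite -[leRHS]ger0_norm ?addr_ge0// -sqrtr_sqr ler_wsqrtr//.
rewrite sqrrD !real_normK ?num_real// lerD2r lerDl.
by rewrite mulrn_wge0// mulr_ge0.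
Qed.

(** The lower bound at [z0] persists with twice the constant near [z0]; compactness of the disc
    makes the constant uniform. *)
Lemma resolvent_bounded (s : R) : s < 1 -> exists2 c : R, 0 < c &
  forall z, normc z <= s -> forall x, rnorm x <= c * rnorm (x - z *: U x).
Proof.
move=> s1; have [u u0 Hu] := L_bound U.
pose D := [set p : R * R | p.1 ^+ 2 + p.2 ^+ 2 <= s ^+ 2].
have [s0|s0] := ltP s 0.
  by exists 1 => // z zs; have := le_lt_trans zs s0; rewrite ltNge normc_ge0.
have DE (x y : R) : normc (x +i* y)%C <= s <-> D (x, y).
  rewrite /D /= -{1}[s]ger0_norm// -sqrtr_sqr ler_sqrt//.
  by rewrite sqr_ge0.
have cD : compact D.
  have sq : compact (`[-1, 1]%classic `*` `[-1, 1]%classic : set (R * R)).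
    by apply: compact_setX; exact: segment_compact.
  apply: subclosed_compact sq _.
    apply: (@closed_comp _ _ (fun p : R * R => p.1 ^+ 2 + p.2 ^+ 2)
       [set x | x <= s ^+ 2]); last exact: closed_le.
    move=> p _; apply: cvgD.
      by apply: (@cvg_comp _ _ _ fst (fun x : R => x ^+ 2)); [exact: cvg_fst|exact: exprn_continuous].
    by apply: (@cvg_comp _ _ _ snd (fun x : R => x ^+ 2)); [exact: cvg_snd|exact: exprn_continuous].
  move=> [x y]; rewrite /D/= => xy; split=> /=; rewrite in_itv/= -ler_norml.
    by rewrite -(@expr_le1 _ 2)// real_normK ?num_real//; nra.
  by rewrite -(@expr_le1 _ 2)// real_normK ?num_real//; nra.
(* Compactness as a near covering: a bound valid locally for all large [c] is valid on the whole
   disc for all large [c]. *)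
have := (near_covering_withinP D).2 ((compact_near_coveringP D).1 cD)
  R +oo_R (fun c p => forall x, rnorm x <= c * rnorm (x - (p.1 +i* p.2)%C *: U x)).
case.
  move=> [x0 y0] /DE z0s; set z0 := (x0 +i* y0)%C in z0s.
  have [B [HB _]] := resolvent (le_lt_trans z0s s1).
  have [c0 c00 Hc0] := L_bound B.
  pose c : R := c0 + 1; have cp : 0 < c by rewrite ltr_wpDl.
  have Hc x : rnorm x <= c * rnorm (x - z0 *: U x).
    rewrite -{1}[x]HB (le_trans (Hc0 _))// ler_wpM2r ?rnorm_ge0//.
    by rewrite lerDl.
  clearbody c.
  (* This radius gives [c * 2h * u <= 1/2], so the perturbation is absorbed in [|x|]. *)
  pose h := (4 * c * (u + 1))^-1.
  have u10 : 0 < u + 1 by rewrite ltr_wpDl.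
  have h0 : 0 < h by rewrite invr_gt0 !mulr_gt0.
  have near1 : \forall z \near (x0, y0), `|x0 - z.1| <= h.
    have /cvgrPdist_le : (z : R * R).1 @[z --> (x0, y0)] --> x0 by exact: cvg_fst.
    by apply.
  have near2 : \forall z \near (x0, y0), `|y0 - z.2| <= h.
    have /cvgrPdist_le : (z : R * R).2 @[z --> (x0, y0)] --> y0 by exact: cvg_snd.
    by apply.
  near=> z c' => _ x; set zz := (_ +i* _)%C.
  have zz0 : normc (zz - z0) <= 2 * h.
    rewrite /zz /z0 (le_trans (normc_le_sum _ _))//.
    have : `|x0 - z.1| <= h by near: z.
    have : `|y0 - z.2| <= h by near: z.
    by rewrite /= (distrC z.1) (distrC z.2); lra.
  have H1 : rnorm (x - z0 *: U x) <=
      rnorm (x - zz *: U x) + 2 * h * (u * rnorm x).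
    have -> : x - z0 *: U x = x - zz *: U x + (zz - z0) *: U x.
      by rewrite scalerBl addrA subrK.
    rewrite (le_trans (rnormD _ _))// lerD2l rnormZ.
    by rewrite ler_pM ?normc_ge0 ?rnorm_ge0.
  have H2 : c * (2 * h * (u * rnorm x)) <= 2^-1 * rnorm x.
    have -> : c * (2 * h * (u * rnorm x)) = 2^-1 * (u / (u + 1) * rnorm x).
      by rewrite /h; field; rewrite !gt_eqF.
    rewrite ler_wpM2l ?invr_ge0// ler_piMl ?rnorm_ge0//.
    by rewrite ler_pdivrMr// mul1r lerDl.
  have H3 := ler_wpM2l (ltW cp) H1; have H4 := Hc x.
  have cc' : 2 * c <= c' by near: c'; apply: nbhs_pinfty_ge; exact: num_real.
  have H5 : 2 * c * rnorm (x - zz *: U x) <= c' * rnorm (x - zz *: U x).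
    by rewrite ler_wpM2r ?rnorm_ge0.
  rewrite mulrDr in H3; have := le_trans H4 (le_trans H3 (lerD (lexx _) H2)).
  by move: H5; set p := rnorm (x - _); rewrite -!mulrA /=; lra.
move=> N [_ HN]; exists (`|N| + 1); first by rewrite ltr_wpDl.
move=> [x y] /DE xy; apply: (HN (`|N| + 1) _ (x, y)) => //.
by rewrite (le_lt_trans (ler_norm _))// ltrDl.
Unshelve. all: by end_near. Qed.

(* The Lipschitz constant L does not depend on k, because passing from k to k + 1
   averages the two resolvents at the square roots of a. *)
Lemma power_resolvents (s : R) : 0 <= s -> s < 1 -> exists2 L : R, 0 < L &
  forall k, exists G : R[i] -> R -> X -> X, forall (a : R[i]) (t : R),
    normc a = 1 -> 0 <= t <= s ->
    [/\ forall x, G a t (x - (a * (t ^+ (2 ^ k))%:C%C) *: iter (2 ^ k) U x) = x,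
     forall x, G a t x - (a * (t ^+ (2 ^ k))%:C%C) *: iter (2 ^ k) U (G a t x) = x
     & forall t' x, 0 <= t' <= s ->
       rnorm (G a t x - G a t' x) <= L * `|t - t'| * rnorm x].
Proof.
move=> s0 s1; have [c c0 Hc] := resolvent_bounded s1.
have [u u0 Hu] := L_bound U.
have [B HB] : exists B : R[i] -> X -> X, forall z, normc z < 1 ->
    (forall x, B z (x - z *: U x) = x) /\
    (forall x, B z x - z *: U (B z x) = x).
  have /choice[B HB] : forall z, exists B : X -> X, normc z < 1 ->
    (forall x, B (x - z *: U x) = x) /\ (forall x, B x - z *: U (B x) = x).
    move=> z; have [/resolvent[B HB]|zn] := pselect (normc z < 1); last by exists id.
    by exists B.
  by exists B.
pose L : R := c * (u * c) + 1.
have L0 : 0 < L by rewrite ltr_wpDl ?mulr_ge0 // ltW.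
exists L => //; elim=> [|k [G HG]].
  exists (fun a t => B (a * t%:C%C)) => a t a1 /andP[t0 ts].
  have ats r : 0 <= r -> normc (a * r%:C%C) = r.
    by move=> r0; rewrite normcM a1 mul1r normc_real ger0_norm.
  have [|H1 H2] := HB (a * t%:C%C); first by rewrite ats// (le_lt_trans ts).
  split=> //= t' x /andP[t'0 t's].
  have [|H1' H2'] := HB (a * t'%:C%C); first by rewrite ats// (le_lt_trans t's).
  set g := B _ x; set g' := B _ x.
  have gE : g - a * t%:C%C *: U g = x := H2 x.
  have g'E : g' - a * t'%:C%C *: U g' = x := H2' x.
  (* Resolvent identity; it yields the Lipschitz constant [c (u c)]. *)
  have dE : g - g' - (a * t%:C%C) *: U (g - g') = (a * (t - t')%:C%C) *: U g'.
    rewrite linearB/= scalerBr opprD opprK addrACA gE -{1}g'E addrACA subrr.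
    by rewrite add0r addrC -scalerBl -mulrBr rmorphB.
  apply: (le_trans (Hc (a * t%:C%C) _ (g - g'))); first by rewrite ats.
  rewrite dE rnormZ normcM a1 mul1r normc_real.
  apply: (@le_trans _ _ (c * (`|t - t'| * (u * (c * rnorm x))))).
    rewrite ler_wpM2l ?(ltW c0)// ler_wpM2l// (le_trans (Hu _))// ler_wpM2l//.
    by rewrite -g'E Hc// ats.
  rewrite (_ : c * _ = c * (u * c) * `|t - t'| * rnorm x); last by ring.
  by rewrite !ler_wpM2r ?rnorm_ge0// lerDl.
(* Both square roots of [a] have modulus 1, so the induction hypothesis applies to them with the
   same [t]. *)
exists (fun a t x => 2^-1 *: (G (sqrtC a) t x + G (- sqrtC a) t x)) => a t a1 ts.
have nsq : normc (sqrtC a) = 1.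
  by apply/eqP; rewrite -(@pexpr_eq1 _ _ 2) ?normc_ge0// -normcX sqrtCK a1.
have nsqN : normc (- sqrtC a) = 1 by rewrite normcN.
have [G1 G2 G3] := HG _ _ nsq ts; have [G1' G2' G3'] := HG _ _ nsqN ts.
have half (x : X) : 2^-1 *: (x + x) = x.
  by rewrite -mulr2n -(scaler_nat 2 x) scalerA mulVf ?scale1r// pnatr_eq0.
set r := (t ^+ (2 ^ k))%:C%C in G1 G2 G1' G2'; set N := (2 ^ k)%N in G1 G2 G1' G2' *.
have rr : a * (t ^+ (2 ^ k.+1))%:C%C = (sqrtC a * r) * (sqrtC a * r).
  rewrite mulrACA -expr2 sqrtCK /r -rmorphM -exprD.
  by rewrite addnn -mul2n -expnS.
set z := sqrtC a * r in G1 G2 rr.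
have zN : - sqrtC a * r = - z by rewrite mulNr.
rewrite zN in G1' G2'.
have AA x : (a * (t ^+ (2 ^ k.+1))%:C%C) *: iter (2 ^ k.+1) U x =
    z *: iter N U (z *: iter N U x).
  by rewrite rr -scalerA L_iterZ -iterD addnn -mul2n -expnS.
split=> [x|x|t' x t's].
- have -> : G (sqrtC a) t (x - (a * (t ^+ (2 ^ k.+1))%:C%C) *: iter (2 ^ k.+1) U x)
      = x + z *: iter N U x.
    rewrite -[RHS]G1 AA L_iterD scalerDr opprD addrA.
    by congr (G _ _ (_ - _)); rewrite addrK.
  have -> : G (- sqrtC a) t (x - (a * (t ^+ (2 ^ k.+1))%:C%C) *: iter (2 ^ k.+1) U x)
      = x - z *: iter N U x.
    rewrite -[RHS]G1' AA L_iterB scalerBr !scaleNr opprB !opprK.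
    by congr (G _ _ _); rewrite addrACA addNr addr0.
  by rewrite addrACA subrr addr0 half.
- set g := G _ t x; set g' := G _ t x.
  have gE : z *: iter N U g = g - x by rewrite -[X in _ = _ - X]G2 -/g opprB addrC subrK.
  have g'E : z *: iter N U g' = x - g'.
    by rewrite -[X in _ = X - _]G2' -/g' scaleNr opprK addrAC subrr add0r.
  have zg : z *: iter N U (z *: iter N U (2^-1 *: (g + g'))) =
      2^-1 *: (z *: iter N U (z *: iter N U g) + z *: iter N U (z *: iter N U g')).
    by rewrite !(L_iterZ, L_iterD) -!scalerDr !scalerA; congr (_ *: _); ring.
  rewrite AA zg gE g'E !L_iterB !scalerBr gE g'E -scalerBr.
  rewrite -[RHS]half; congr (_ *: _).
  set q := z *: iter N U x.
  rewrite opprD !opprB addrACA.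
  have -> : g + (q + (x - g)) = x + q by rewrite addrCA [g + _]addrC subrK addrC.
  have -> : g' + (x - g' - q) = x - q by rewrite addrA [g' + _]addrC subrK.
  by rewrite addrACA subrr addr0.
rewrite -scalerBr rnormZ opprD addrACA.
have n2 : normc (2^-1 : R[i]) = 2^-1.
  rewrite normcV; congr (_^-1).
  have -> : (2 : R[i]) = (2 : R)%:C%C by rewrite rmorph_nat.
  by rewrite normc_real ger0_norm.
have := rnormD (G (sqrtC a) t x - G (sqrtC a) t' x)
  (G (- sqrtC a) t x - G (- sqrtC a) t' x).
have := G3 t' x t's; have := G3' t' x t's.
rewrite n2; lra.
Qed.

Definition dyadic_growth (t : R) := exists C k0, forall k, (k0 <= k)%N ->
  forall x, t ^+ (2 ^ k) * rnorm (iter (2 ^ k) U x) <= C * rnorm x.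

(* Below t0 the resolvents G 1 t1 tend to the identity; the uniform Lipschitz
   bound keeps G 1 t2 at distance at most 1/2 from it, so its inverse
   1 - t2 ^ (2 ^ k) U ^ (2 ^ k) is bounded. *)
Lemma dyadic_growth_step (s L t0 t1 t2 : R) :
  (forall k, exists G : R[i] -> R -> X -> X, forall (a : R[i]) (t : R),
    normc a = 1 -> 0 <= t <= s ->
    [/\ forall x, G a t (x - (a * (t ^+ (2 ^ k))%:C%C) *: iter (2 ^ k) U x) = x,
     forall x, G a t x - (a * (t ^+ (2 ^ k))%:C%C) *: iter (2 ^ k) U (G a t x) = x
     & forall t' x, 0 <= t' <= s ->
       rnorm (G a t x - G a t' x) <= L * `|t - t'| * rnorm x]) ->
  dyadic_growth t0 -> 0 <= t1 < t0 -> t1 <= t2 <= s -> L * (t2 - t1) <= 4^-1 ->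
  dyadic_growth t2.
Proof.
move=> HG [C [k0 HC]] /andP[t10 t1t0] /andP[t12 t2s] Lt.
have t00 : 0 < t0 by exact: le_lt_trans t1t0.
have t20 : 0 <= t2 := le_trans t10 t12.
have C0 : 0 < `|C| + 1 by rewrite ltr_wpDl.
have [|||N HN] := @exp_small R (t1 / t0) (8^-1 / (`|C| + 1)).
- by rewrite divr_ge0// ltW.
- by rewrite ltr_pdivrMr// mul1r.
- by rewrite divr_gt0.
(* For [y = x - t2^n U^n x] the proof gives [|x - y| <= |y|/2], hence [|y| <= 2|x|]; the constant 3
   leaves room. *)
exists 3, (maxn k0 N) => k; rewrite geq_max => /andP[kk0 kN] x.
have {}HC := HC k kk0; have [G {}HG] := HG k.
set n := (2 ^ k)%N in HC HG *; set A := iter n U in HC HG *.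
have nN : (N <= n)%N by rewrite (leq_trans kN)// ltnW// ltn_expl.
have small y : t1 ^+ n * rnorm (A y) <= 8^-1 * rnorm y.
  have -> : t1 ^+ n = (t1 / t0) ^+ n * t0 ^+ n.
    by rewrite expr_div_n mulfVK// expf_neq0// gt_eqF.
  rewrite -mulrA; apply: (@le_trans _ _ (8^-1 / (`|C| + 1) * ((`|C| + 1) * rnorm y))).
    apply: ler_pM; rewrite ?HN//.
    - by rewrite exprn_ge0// divr_ge0// ltW.
    - by rewrite mulr_ge0 ?rnorm_ge0// exprn_ge0// ltW.
    rewrite (le_trans (HC y))// ler_wpM2r ?rnorm_ge0//.
    by rewrite (le_trans (ler_norm _))// lerDl.
  by rewrite mulrA mulfVK// gt_eqF.
have n1 : normc (1 : R[i]) = 1 by rewrite normc1.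
have t1s : 0 <= t1 <= s by rewrite t10 (le_trans t12).
have t2s' : 0 <= t2 <= s by rewrite t20.
have [_ H1 H12] := HG 1 t1 n1 t1s; have [H2 _ _] := HG 1 t2 n1 t2s'.
have norm1 (t : R) y : 0 <= t ->
    rnorm ((1 * (t ^+ n)%:C%C) *: A y) = t ^+ n * rnorm (A y).
  by move=> t_ge0; rewrite rnormZ mul1r normc_real ger0_norm// exprn_ge0.
have [y yE] : exists y, y = x - (1 * (t2 ^+ n)%:C%C) *: A x by eexists.
have Gy1 : rnorm (G 1 t1 y - y) <= 7^-1 * rnorm y.
  have H : rnorm (G 1 t1 y - y) <= 8^-1 * rnorm (G 1 t1 y).
    by rewrite -{2}(H1 y) opprB addrC subrK norm1.
  have := rnorm_sub (G 1 t1 y) y; lra.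
have Gy2 : rnorm (G 1 t1 y - G 1 t2 y) <= 4^-1 * rnorm y.
  rewrite (le_trans (H12 _ _ t2s'))// ler_wpM2r ?rnorm_ge0//.
  by rewrite distrC ger0_norm// subr_ge0.
have Gx : G 1 t2 y = x by rewrite yE H2.
have Gy3 : rnorm (x - y) <= 2^-1 * rnorm y.
  have -> : x - y = (G 1 t1 y - y) - (G 1 t1 y - x).
    by rewrite opprB [RHS]addrC addrA subrK.
  have := rnormB (G 1 t1 y - y) (G 1 t1 y - x).
  rewrite Gx in Gy2; have := rnorm_ge0 y; lra.
have yx : rnorm y <= 2 * rnorm x.
  have := rnorm_sub y x; rewrite -(rnormN (y - x)) opprB; lra.
rewrite -norm1// (_ : _ *: A x = x - y); last by rewrite yE opprB addrC subrK.
by have := rnorm_ge0 x; lra.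
Qed.

(** The start [r = 1/(u+1)] is trivial. Since [L] is fixed, steps of constant length [h = 1/(8L)]
    reach [s] after finitely many. *)
Lemma dyadic_growth_lt1 (s : R) : 0 < s -> s < 1 -> dyadic_growth s.
Proof.
move=> s0 s1; have [L L0 HG] := power_resolvents (ltW s0) s1.
have [u u0 Hu] := L_bound U.
have u10 : 0 < u + 1 by rewrite ltr_wpDl.
pose r := (u + 1)^-1; have r0 : 0 < r by rewrite invr_gt0.
pose h := (8 * L)^-1; have h0 : 0 < h by rewrite invr_gt0 mulr_gt0.
have step j : dyadic_growth (Num.min s (r + h *+ j)).
  elim: j => [|j IH].
    exists 1, 0%N => k _ x; set n := (2 ^ k)%N.
    have ub : rnorm (iter n U x) <= (u + 1) ^+ n * rnorm x.
      elim: n => [|n IH]; first by rewrite mul1r.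
      rewrite iterS (le_trans (Hu _))// exprS -mulrA.
      by rewrite ler_pM ?rnorm_ge0// lerDl.
    have mr : Num.min s (r + h *+ 0) <= r by rewrite addr0 ge_min lexx orbT.
    have m0 : 0 <= Num.min s (r + h *+ 0) by rewrite addr0 le_min !ltW.
    apply: (@le_trans _ _ (r ^+ n * ((u + 1) ^+ n * rnorm x))).
      by rewrite ler_pM ?rnorm_ge0 ?exprn_ge0// lerXn2r// nnegrE ltW.
    by rewrite mulrA -exprMn mulVf ?gt_eqF// expr1n.
  set t := Num.min s (r + h *+ j) in IH.
  have t0 : 0 < t by rewrite lt_min s0 ltr_wpDr// mulrn_wge0// ltW.
  have tt : t <= Num.min s (r + h *+ j.+1).
    rewrite le_min !ge_min lexx/=; apply/orP; right.
    by rewrite lerD2l mulrS lerDr ltW.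
  have tt' : Num.min s (r + h *+ j.+1) <= t + h.
    rewrite /t addr_minl le_min !ge_min lerDl (ltW h0)/=.
    by apply/orP; right; rewrite mulrSr addrA.
  (* The auxiliary point lies strictly below [t] and within [2h] of the new value, so [L] times the
     gap is at most 1/4. *)
  apply: (@dyadic_growth_step s L t (Num.max 0 (t - h))) => //.
  - by rewrite le_max lexx/= gt_max t0/= ltrBlDr ltrDl.
  - rewrite ge_min lexx/= andbT (le_trans _ tt)//.
    by rewrite ge_max (ltW t0)/= lerBlDr lerDl ltW.
  apply: (@le_trans _ _ (L * (2 * h))).
    rewrite (ler_wpM2l (ltW L0))//.
    have -> : 2 * h = (t + h) - (t - h) by ring.
    by apply: lerB => //; rewrite le_max lexx orbT.
  by rewrite /h le_eqVlt; apply/orP; left; apply/eqP; field; rewrite gt_eqF.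
have := step (Num.bound (s / h)).
rewrite (_ : Num.min s _ = s)//; apply/min_idPl.
have : s / h < (Num.bound (s / h))%:R by rewrite archi_boundP// divr_ge0 ?ltW.
rewrite ltr_pdivrMr// mulr_natl => sh.
by rewrite (le_trans (ltW sh))// lerDr ltW.
Qed.

(** For [1/e < s < 1] the constant is beaten by [(s e)^N] at one large [N = 2^k], so [U^N] has norm
    at most [e^N]. Division by [N] then gives all powers, with [D] bounding the remainders. *)
Lemma power_growth (e : R) : 1 < e -> exists2 C, 0 < C &
  forall n x, rnorm (iter n U x) <= C * e ^+ n * rnorm x.
Proof.
move=> e1; pose s := 2 / (1 + e).
have e0 : 0 < 1 + e by lra.
have s0 : 0 < s by rewrite divr_gt0.
have s1 : s < 1 by rewrite ltr_pdivrMr//; lra.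
have se : 1 < s * e by rewrite mulrAC ltr_pdivlMr//; lra.
have e0' : 0 < e by lra.
have [C [k0 HC]] := dyadic_growth_lt1 s0 s1.
have se0 : 0 < s * e by rewrite mulr_gt0.
have C0 : 0 < `|C| + 1 by rewrite ltr_wpDl.
have [|||N0 HN] := @exp_small R (s * e)^-1 (`|C| + 1)^-1.
- by rewrite invr_ge0 ltW.
- by rewrite invf_lt1.
- by rewrite invr_gt0.
pose k := maxn k0 N0; pose N := (2 ^ k)%N.
have UN x : rnorm (iter N U x) <= e ^+ N * rnorm x.
  have H := HC k (leq_maxl _ _) x.
  have HN' : (`|C| + 1) <= (s * e) ^+ N.
    rewrite -lef_pV2 ?posrE ?exprn_gt0// -exprVn HN//.
    by rewrite (leq_trans (leq_maxr k0 N0))// ltnW// ltn_expl.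
  rewrite -(ler_pM2l (exprn_gt0 N s0)) (le_trans H)// mulrA -exprMn.
  rewrite ler_wpM2r ?rnorm_ge0// (le_trans _ HN')//.
  by rewrite (le_trans (ler_norm _))// lerDl.
have N1 : (0 < N)%N by rewrite expn_gt0.
have [D D0 HD] : exists2 D : R, 0 < D & forall j, (j < N)%N -> forall x,
    rnorm (iter j U x) <= D * rnorm x.
  elim: (N) => [|n [D D0 HD]]; first by exists 1.
  have [c c0 Hc] := L_iter_bound U n.
  exists (D + c); first exact: ltr_wpDr.
  move=> j; rewrite ltnS leq_eqVlt => /orP[/eqP->|jn] x.
    by rewrite (le_trans (Hc x))// ler_wpM2r ?rnorm_ge0// lerDr ltW.
  by rewrite (le_trans (HD _ jn x))// ler_wpM2r ?rnorm_ge0// lerDl.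
exists D => // n x; rewrite {1}(divn_eq n N) addnC iterD.
rewrite (le_trans (HD _ (ltn_pmod n N1) _))// -mulrA (ler_wpM2l (ltW D0))//.
apply: (@le_trans _ _ (e ^+ (n %/ N * N) * rnorm x)).
  elim: (n %/ N)%N => [|q IH]; first by rewrite mul1r.
  by rewrite mulSn iterD (le_trans (UN _))// exprD -mulrA ler_wpM2l// exprn_ge0// ltW.
by rewrite ler_wpM2r ?rnorm_ge0// ler_eXn2l// leq_divM.
Qed.

End gelfand.

(** * Comparison of spectra *)

Section spectrum_criteria.
Variables (R : realType) (X : normedModType R[i]).
Implicit Type A : 'L(X, X).

Lemma posC (e : R[i]) : 0 < e -> exists2 r : R, 0 < r & e = (r%:C)%C.
Proof.
move=> e0; exists (complex.Re e); last by rewrite RRe_real ?gtr0_real.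
by rewrite -ltcR RRe_real ?gtr0_real.
Qed.

Lemma ap_spectrumP A l : ap_spectrum A l <-> ~ bounded_below A l.
Proof.
split=> [[x [x1 xl]] [c Hc]|nb].
  have c0 : 0 < `|c| + 1 by rewrite ltr_wpDl.
  have e0 : (0 : R[i]) < (((`|c| + 1)^-1)%:C)%C by rewrite ltcR invr_gt0.
  move/cvgrPdist_lt : xl => /(_ _ e0)[N _ /(_ N (leqnn N))/=].
  rewrite sub0r normrN rnormE ltcR => H.
  have := Hc (x N); have -> : rnorm (x N) = 1 by rewrite /rnorm x1.
  apply/negP; rewrite -ltNge.
  apply: (@le_lt_trans _ _ ((`|c| + 1) * rnorm (A (x N) - l *: x N))).
    rewrite ler_wpM2r ?rnorm_ge0// (le_trans (ler_norm _))// lerDl//.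
  by rewrite mulrC -ltr_pdivlMr// mul1r.
have H n : exists x, rnorm x = 1 /\ rnorm (A x - l *: x) <= n.+1%:R^-1.
  have /existsNP[x /negP] : ~ forall x, rnorm x <= n.+1%:R * rnorm (A x - l *: x).
    by move=> H; apply: nb; exists n.+1%:R.
  rewrite -ltNge => Hx.
  have x0 : 0 < rnorm x by rewrite (le_lt_trans _ Hx)// mulr_ge0 ?rnorm_ge0.
  exists (((rnorm x)^-1)%:C%C *: x).
  rewrite linearZ/= scalerA [l * _]mulrC -scalerA -scalerBr !rnormZ !normc_real.
  have xV : 0 <= (rnorm x)^-1 by rewrite invr_ge0 ltW.
  rewrite !(ger0_norm xV); split; first by rewrite mulVf// gt_eqF.
  by rewrite mulrC ler_pdivrMr// ler_pdivlMl// ltW.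
have /choice[x Hx] := H; exists x; split=> [n|].
  by rewrite rnormE (Hx n).1.
apply/cvgrPdist_lt => e /posC[r r0 ->]; near=> n.
rewrite sub0r normrN rnormE ltcR (le_lt_trans (Hx n).2)//.
near: n; exact: near_infty_natSinv_lt (PosNum r0).
Unshelve. all: by end_near. Qed.

(** The lower bound provides both injectivity and continuity of the algebraic inverse. *)
Lemma spectrumP A l : spectrum A l <->
  ~ (bounded_below A l /\ forall y, exists z, A z - l *: z = y).
Proof.
suff H : (exists B, is_inverse (A - l *: (idfun : 'L(X, X))) B) <->
    (bounded_below A l /\ forall y, exists z, A z - l *: z = y).
  by split=> nB HB; apply: nB; apply/H.
split=> [[B [AB BA]]|[[c Hc] sur]].
  split; last by move=> y; exists (B y); exact: BA.
  have [c c0 Hc] := L_bound B; exists c => x.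
  by rewrite -{1}[x]AB; exact: Hc.
have [D DE] : exists D : 'L(X, X), forall x, D x = A x - l *: x.
  by exists (A - l *: (idfun : 'L(X, X))).
have inj x : D x = 0 -> x = 0.
  move=> Dx; apply: rnorm0_eq0; apply/eqP; rewrite eq_le rnorm_ge0 andbT.
  by rewrite (le_trans (Hc x))// -DE Dx rnorm0 mulr0.
have /choice[g Hg] : forall y, exists z, D z = y.
  by move=> y; have [z Hz] := sur y; exists z; rewrite DE.
have gl : linear g.
  move=> a x y; apply/eqP; rewrite -subr_eq0; apply/eqP/inj.
  by rewrite linearB linearD linearZ/= !Hg subrr.
have gc : continuous g.
  pose L := HB.pack_for {linear X -> X} g (GRing.isLinear.Build R[i] X X *:%R _ gl).
  apply: (@bounded_linear_continuous _ _ _ L); apply/linear_boundedP.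
  near=> r => y; rewrite !rnormE.
  have cr : c%:C%C <= r by near: r; apply: nbhs_pinfty_ge; by rewrite realE !lecR; exact: le_total.
  apply: (@le_trans _ _ (c%:C%C * (rnorm y)%:C%C)).
    by rewrite -rmorphM/= lecR -{2}[y]Hg DE; exact: Hc.
  by rewrite ler_wpM2r// lecR rnorm_ge0.
exists (mkL gl gc); split=> [x|y].
  have -> : (A - l *: (idfun : 'L(X, X))) x = D x by rewrite DE.
  by apply/eqP; rewrite -subr_eq0; apply/eqP/inj; rewrite linearB/= Hg subrr.
have -> : (A - l *: (idfun : 'L(X, X))) (mkL gl gc y) = D (g y) by rewrite DE.
exact: Hg.
Unshelve. all: by end_near. Qed.

End spectrum_criteria.

(** * The weighted operator at nonzero values and at 0 *)

Section weighted_spectrum.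
Variables (R : realType) (K : compactHausdorffType) (X : normedModType R[i]).
Variables (m : CK R K -> 'L(X, X)) (U V : 'L(X, X)).
Variables (phi psi : continuousType K K).
Hypothesis S : weighted_setup m U V phi psi.
Hypothesis cX : geometrically_complete X.
Variables (w : CK R K).
Let T : 'L(X, X) := m w \o U.

Let scale (l : R[i]) x : l != 0 ->
  T x - l *: x = l *: ((m (l^-1 *: w) \o U : 'L(X, X)) x - x).
Proof. by move=> l0; rewrite /= (su_Z S) scalerBr scalerA mulfV// scale1r. Qed.

Lemma bounded_below_scale l : l != 0 ->
  bounded_below T l <-> bounded_below (m (l^-1 *: w) \o U : 'L(X, X)) 1.
Proof.
move=> l0; have nl0 : normc l != 0 by apply: contra l0 => /eqP/eq0_normc ->.
split=> -[c Hc].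
  exists (c * normc l) => x; rewrite scale1r -mulrA -rnormZ -scale//.
exists (c / normc l) => x; rewrite scale// rnormZ mulrA divfK//.
by have := Hc x; rewrite scale1r.
Qed.

Lemma surjective_scale l : l != 0 ->
  (forall y, exists z, T z - l *: z = y) <->
  (forall y, exists z, (m (l^-1 *: w) \o U : 'L(X, X)) z - z = y).
Proof.
move=> l0; split=> H y.
  have [z] := H (l *: y); rewrite scale// => Hz; exists z.
  by rewrite -[RHS](scale1r) -(mulVf l0) -scalerA -Hz scalerA mulVf// scale1r.
have [z Hz] := H (l^-1 *: y); exists z.
by rewrite scale// Hz scalerA mulfV// scale1r.
Qed.

Lemma bounded_below_nz l : l != 0 ->
  bounded_below T l <-> ~ localized_orbits (l^-1 *: w) phi psi.
Proof.
move=> l0; rewrite bounded_below_scale//; split.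
  by move=> bb loc; apply: (not_bounded_below_of_localized S loc).
exact: (bounded_below_of_not_localized S).
Qed.

Lemma invertible_nz l : l != 0 ->
  bounded_below T l /\ (forall y, exists z, T z - l *: z = y) <->
  ~ localized_orbits (l^-1 *: w) phi psi /\
  ~ colocalized_orbits (l^-1 *: w) phi psi.
Proof.
move=> l0; rewrite bounded_below_nz// surjective_scale//; split=> -[nloc].
  move=> sur; split=> //; apply: (not_colocalized_of_invertible S) sur.
  exact: (bounded_below_of_not_localized S).
by move=> ncol; split=> //; exact: (surjective_of_not_colocalized S cX ncol).
Qed.

(** If [w] is small at a point, the indicator [g] of a clopen set where it is small yields vectors
    [V (g x)] nearly annihilated by [T]. With [invertible_zero], a lower bound at 0 thus already
    forces invertibility. *)
Lemma bounded_below_zero :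
  bounded_below T 0 -> exists2 e : R, 0 < e & forall k, e <= normc (w k).
Proof.
move=> [c0 Hc0]; have [u u0 Hu] := L_bound U.
pose c : R := `|c0| + 1; have cp : 0 < c by rewrite ltr_wpDl.
have Hc x : rnorm x <= c * rnorm (T x).
  apply: (le_trans (Hc0 x)); rewrite scale0r subr0 ler_wpM2r ?rnorm_ge0//.
  by rewrite /c (le_trans (ler_norm _))// lerDl.
clearbody c; have u10 : 0 < u + 1 by rewrite ltr_wpDl.
(* Chosen so that [u c e <= 1/2]. *)
pose e : R := (2 * (u + 1) * c)^-1; have e0 : 0 < e by rewrite invr_gt0 !mulr_gt0.
exists e => // k; rewrite leNgt; apply/negP => wk.
pose B := closure [set k | normc (w k) < e].
have B1 : forall k, B k -> normc (w k) <= e.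
  by apply: closure_sub_closed; [exact: closed_normc_le|move=> k' /ltW].
have cB : clopen B by exact: clopen_closure (su_extr S) (open_normc_lt _ _).
have Bk : B k by apply: subset_closure.
have [g gE] := @clopen_indicator R K B cB.
have gg : g * g = g.
  apply: CKP => k'; rewrite -[LHS]/(g k' * g k') gE.
  by case: (k' \in B); rewrite ?mulr1 ?mulr0.
have [x gx] : exists x, m g x <> 0.
  apply/not_existsP => H.
  have /(congr1 (fun f : CK R K => f k)) : g = 0.
    by apply: (su_inj S) => x; apply: contrapT; exact: H.
  by rewrite gE mem_set// => /eqP; rewrite oner_eq0.
have Tx : rnorm (T (V (m g x))) <= e * rnorm (m g x).
  rewrite /= (su_VK S).
  have -> : m w (m g x) = m (w * g) (m g x).
    by rewrite (su_M S w g) -[m g (m g x)](su_M S) gg.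
  apply: (su_norm S); first exact: ltW.
  move=> k'; rewrite -[(w * g) k']/(w k' * g k') gE.
  have [Bk'|Bk'] := pselect (B k'); first by rewrite mem_set// mulr1 B1.
  by rewrite memNset// mulr0 normc0 ltW.
have Vx : rnorm (m g x) <= u * rnorm (V (m g x)).
  by rewrite -{1}(su_VK S (m g x)) Hu.
have H1 := ler_wpM2l u0 (Hc (V (m g x))).
have H2 := ler_wpM2l u0 (ler_wpM2l (ltW cp) Tx).
have : rnorm (m g x) <= 2^-1 * rnorm (m g x).
  rewrite (le_trans Vx)// (le_trans H1)// (le_trans H2)//.
  rewrite !mulrA ler_wpM2r ?rnorm_ge0//.
  rewrite (_ : u * c * e = 2^-1 * (u / (u + 1))); last first.
    by rewrite /e; field; rewrite !gt_eqF.
  by rewrite ler_piMr ?invr_ge0// ler_pdivrMr// mul1r lerDl.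
move=> H; apply: gx; apply: rnorm0_eq0; apply/eqP.
by rewrite eq_le rnorm_ge0 andbT; lra.
Qed.

Lemma invertible_zero (e : R) : 0 < e -> (forall k, e <= normc (w k)) ->
  bounded_below T 0 /\ forall y, exists z, T z - 0 *: z = y.
Proof.
move=> e0 we; have w0 k : [set: K] k -> w k != 0.
  by move=> _; apply: contraTneq (we k) => ->; rewrite normc0 -ltNge.
have [v vE] := @clopen_inverse R K w setT clopenT w0.
have vw : v * w = 1.
  apply: CKP => k; rewrite -[LHS]/(v k * w k) vE mem_set// mulVf//.
  exact: w0.
have [c c0 Hc] := L_bound (m v); have [c' c'0 Hc'] := L_bound V.
split.
  exists (c' * c) => x; rewrite scale0r subr0 -{1}[x](su_UK S).
  rewrite (le_trans (Hc' _))// -mulrA ler_wpM2l//.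
  have -> : U x = m v (T x) by rewrite /= -(su_M S) vw (su_1 S).
  exact: Hc.
move=> y; exists (V (m v y)).
by rewrite scale0r subr0 /= (su_VK S) -(su_M S) mulrC vw (su_1 S).
Qed.

End weighted_spectrum.

(** * Transfer between two modules over the same dynamics *)

Section transfer.
Variables (R : realType) (K : compactHausdorffType) (X Y : normedModType R[i]).
Variables (m : CK R K -> 'L(X, X)) (U V : 'L(X, X)).
Variables (n : CK R K -> 'L(Y, Y)) (P Q : 'L(Y, Y)).
Variables (phi psi : continuousType K K) (w : CK R K).
Hypotheses (S : weighted_setup m U V phi psi) (S' : weighted_setup n P Q phi psi).
Hypotheses (cX : geometrically_complete X) (cY : geometrically_complete Y).
Let T : 'L(X, X) := m w \o U.
Let T' : 'L(Y, Y) := n w \o P.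

(** The criteria speak only of [w], [phi] and [psi], never of the module. *)
Lemma bounded_below_transfer l : bounded_below T l -> bounded_below T' l.
Proof.
have [->|l0] := eqVneq l 0.
  move=> /(bounded_below_zero S)[e e0 we].
  by have [] := invertible_zero S' e0 we.
by move=> /(bounded_below_nz S w l0) H; apply/(bounded_below_nz S' w l0).
Qed.

Lemma invertible_transfer l :
  bounded_below T l /\ (forall y, exists z, T z - l *: z = y) ->
  bounded_below T' l /\ (forall y, exists z, T' z - l *: z = y).
Proof.
have [->|l0] := eqVneq l 0.
  move=> [/(bounded_below_zero S)[e e0 we] _].
  exact: (invertible_zero S' e0 we).
move=> /(invertible_nz S cX w l0) H.
exact/(invertible_nz S' cY w l0).
Qed.

End transfer.

(** * Completeness of [X] and of [C(K)] *)

Section completeness.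
Variable R : realType.

Lemma half_exp_small (C e : R) : 0 < e ->
  exists N, forall n, (N <= n)%N -> C * 2^-1 ^+ n <= e.
Proof.
move=> e0; have C0 : 0 < `|C| + 1 by rewrite ltr_wpDl.
have [|||N HN] := @exp_small R 2^-1 (e / (`|C| + 1)).
- by rewrite invr_ge0.
- by rewrite invf_lt1 ?ltr1n.
- by rewrite divr_gt0.
exists N => n /HN; rewrite ler_pdivlMr// mulrC; apply: le_trans.
rewrite ler_wpM2r ?exprn_ge0 ?invr_ge0//.
by rewrite (le_trans (ler_norm _))// lerDl.
Qed.

Lemma complete_geometric (X : completeNormedModType R[i]) :
  geometrically_complete X.
Proof.
move=> u C Hu.
have Hd n j : rnorm (u (n + j)%N - u n) <= 2 * C * (2^-1 ^+ n - 2^-1 ^+ (n + j)).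
  elim: j => [|j IH]; first by rewrite addn0 !subrr mulr0 rnorm0.
  have -> : u (n + j.+1)%N - u n = (u (n + j).+1 - u (n + j)%N) + (u (n + j)%N - u n).
    by rewrite addnS addrA subrK.
  rewrite (le_trans (rnormD _ _))//.
  have := Hu (n + j)%N; rewrite addnS exprS; lra.
have C0 : 0 <= C by have := Hu 0%N; rewrite mulr1; apply: le_trans; exact: rnorm_ge0.
have Hd' n p : (n <= p)%N -> rnorm (u p - u n) <= 2 * C * 2^-1 ^+ n.
  move=> np; rewrite -(subnKC np) (le_trans (Hd _ _))// ler_wpM2l ?mulr_ge0//.
  by rewrite gerBl exprn_ge0// invr_ge0.
have /cauchy_cvg/cvg_ex[l ul] : cauchy (u @ \oo).
  apply/cauchy_exP => e /posC[r r0 ->].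
  have r2 : 0 < r / 2 by lra.
  have [N HN] := half_exp_small (2 * C) r2.
  exists (u N); exists N => // n /= Nn; rewrite -ball_normE/=.
  rewrite rnormE ltcR -rnormN opprB (le_lt_trans (Hd' _ _ Nn))//.
  by have := HN N (leqnn N); lra.
exists l => e e0.
have [N HN] := half_exp_small C e0.
have eC : (0 : R[i]) < (e%:C)%C by rewrite ltcR.
move/cvgrPdist_lt : ul => /(_ _ eC)[N' _ HN'].
exists (maxn N N'); split; last by apply: HN; exact: leq_maxl.
have /HN' : (N' <= maxn N N')%N by exact: leq_maxr.
by rewrite /= rnormE ltcR -rnormN opprB => /ltW.
Qed.

Variable K : compactHausdorffType.

Lemma CK_rnormP (f : CK R K) (c : R) : 0 <= c ->
  rnorm f <= c <-> forall k, normc (f k) <= c.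
Proof.
move=> c0; split=> [fc k|fc].
  have := le_rsup (CK_bounded f) (I : [set: K] k).
  by move/le_trans; apply.
rewrite -[rnorm f]/(rsup [set: K] (f : K -> R[i])).
by apply: rsup_le => // k _; exact: fc.
Qed.

(** The intervals of radius [2 C 2^-n] about [a n] are nested; the supremum of their left ends lies
    in all of them. *)
Lemma real_geometric (a : nat -> R) (C : R) :
  (forall n, `|a n.+1 - a n| <= C * 2^-1 ^+ n) ->
  exists l, forall n, `|a n - l| <= 2 * C * 2^-1 ^+ n.
Proof.
move=> Ha.
pose lo n := a n - 2 * C * 2^-1 ^+ n; pose hi n := a n + 2 * C * 2^-1 ^+ n.
have loS n : lo n <= lo n.+1.
  by rewrite /lo exprS; have := Ha n; rewrite ler_norml => /andP[]; lra.
have hiS n : hi n.+1 <= hi n.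
  by rewrite /hi exprS; have := Ha n; rewrite ler_norml => /andP[]; lra.
have lohi n : lo n <= hi n.
  have := le_trans (normr_ge0 _) (Ha n); rewrite /lo /hi; lra.
have lo_mono n p : (n <= p)%N -> lo n <= lo p.
  by move=> /subnKC <-; elim: (p - n)%N => [|j IH]; rewrite ?addn0// addnS (le_trans IH).
have hi_mono n p : (n <= p)%N -> hi p <= hi n.
  by move=> /subnKC <-; elim: (p - n)%N => [|j IH]; rewrite ?addn0// addnS (le_trans _ IH).
have lohi' n p : lo n <= hi p.
  have [np|/ltnW pn] := leqP n p; first exact: le_trans (lo_mono _ _ np) (lohi p).
  exact: le_trans (lohi n) (hi_mono _ _ pn).
exists (sup (range lo)) => n.
have H1 : lo n <= sup (range lo).
  by apply: ub_le_sup; [exists (hi 0%N) => _ [p _ <-]|exists n].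
have H2 : sup (range lo) <= hi n.
  by apply: ge_sup; [exists (lo 0%N), 0%N|move=> _ [p _ <-]].
by rewrite ler_norml; move: H1 H2; rewrite /lo /hi; lra.
Qed.

Lemma normc_ge_ReIm (z : R[i]) :
  `|complex.Re z| <= normc z /\ `|complex.Im z| <= normc z.
Proof.
by case: z => x y /=; rewrite -!sqrtr_sqr !ler_wsqrtr// ?lerDl ?lerDr ?sqr_ge0.
Qed.

(** Real and imaginary parts converge pointwise at a rate independent of [k], so the limit is
    uniform and continuous. *)
Lemma CK_geometric : geometrically_complete (CK R K).
Proof.
move=> u C Hu.
have C0 : 0 <= C by have := Hu 0%N; rewrite mulr1; apply: le_trans; exact: rnorm_ge0.
have e0 n : 0 <= C * 2^-1 ^+ n by rewrite mulr_ge0// exprn_ge0// invr_ge0.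
have Hk n k : normc (u n.+1 k - u n k) <= C * 2^-1 ^+ n.
  exact: ((CK_rnormP _ (e0 n)).1 (Hu n) k).
have /choice[x Hx] : forall k, exists l, forall n,
    `|complex.Re (u n k) - l| <= 2 * C * 2^-1 ^+ n.
  move=> k; apply: real_geometric => n.
  by rewrite -raddfB (le_trans (normc_ge_ReIm _).1).
have /choice[y Hy] : forall k, exists l, forall n,
    `|complex.Im (u n k) - l| <= 2 * C * 2^-1 ^+ n.
  move=> k; apply: real_geometric => n.
  by rewrite -raddfB (le_trans (normc_ge_ReIm _).2).
pose g k := (x k +i* y k)%C.
have Hg n k : normc (u n k - g k) <= 4 * C * 2^-1 ^+ n.
  have -> : u n k - g k =
      ((complex.Re (u n k) - x k) +i* (complex.Im (u n k) - y k))%C.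
    by case: (u n k).
  have := normc_le_sum (complex.Re (u n k) - x k) (complex.Im (u n k) - y k).
  have := Hx k n; have := Hy k n; lra.
have gc : continuous g.
  move=> k; apply/cvgrPdist_lt => e /posC[r r0 ->].
  have r4 : 0 < r / 4 by lra.
  have [N HN] := half_exp_small (4 * C) r4.
  have uk : \forall k' \near k, `|u N k - u N k'| < ((r / 4)%:C)%C.
    have /cvgrPdist_lt := @CK_cont R K (u N) k; apply.
    by rewrite ltcR; lra.
  near=> k'.
  have H1 : `|u N k - u N k'| < ((r / 4)%:C)%C by near: k'.
  rewrite [`|_|]rnormE ltcR in H1; rewrite [`|_|]rnormE ltcR.
  rewrite !rnorm_normc in H1 *.
  have -> : g k - g k' = (u N k - u N k') - (u N k - g k) + (u N k' - g k').
    by ring.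
  have := le_normcD (u N k - u N k' - (u N k - g k)) (u N k' - g k').
  have := le_normcD (u N k - u N k') (- (u N k - g k)); rewrite normcN.
  have := Hg N k; have := Hg N k'; have := HN N (leqnn N); lra.
exists (mkCK gc) => e e1.
have [N1 HN1] := half_exp_small (4 * C) e1; have [N2 HN2] := half_exp_small C e1.
exists (maxn N1 N2); split; last by apply: HN2; exact: leq_maxr.
apply/CK_rnormP; first exact: ltW.
by move=> k; rewrite (le_trans (Hg _ _))// HN1// leq_maxl.
Unshelve. all: by end_near. Qed.

End completeness.

(** * The module [X] and [C(K)] as instances of the common setup *)

Lemma L_rnorm (R : realType) (X : normedModType R[i]) (A : 'L(X, X)) x :
  rnorm (A x) <= rnorm A * rnorm x.
Proof.
have [->|x0] := eqVneq x 0; first by rewrite linear0 !rnorm0 mulr0.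
have nx0 : 0 < rnorm x.
  by rewrite lt_def rnorm_ge0 andbT; apply: contra x0 => /eqP/rnorm0_eq0 ->.
have xV : 0 <= (rnorm x)^-1 by rewrite invr_ge0 ltW.
have nC : normc (((rnorm x)^-1)%:C%C) = (rnorm x)^-1 by rewrite normc_real ger0_norm.
have uy : unit_ball (((rnorm x)^-1)%:C%C *: x).
  by rewrite /unit_ball/= rnormE rnormZ nC mulVf ?gt_eqF.
have := le_rsup (L_bounded A) uy.
by rewrite linearZ rnormZ nC mulrC ler_pdivrMr.
Qed.

(** For [z] nonzero in the open disc, [1 - z U = - z (U - z^-1)]; for every [z] there,
    [1 - z V = (U - z) V]. Both are invertible off the circle, so [power_growth] applies to [U] and
    to [V]. *)
Lemma spectrum_growth (R : realType) (X : normedModType R[i]) (U V : 'L(X, X)) :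
  is_inverse U V -> spectrum U `<=` [set z | `|z| = 1] ->
  forall e : R, 1 < e -> exists2 C : R, 0 < C & forall n (x : X),
    rnorm (iter n U x) <= C * e ^+ n * rnorm x /\
    rnorm (iter n V x) <= C * e ^+ n * rnorm x.
Proof.
move=> [UV VU] sU.
have inv l : normc l != 1 -> exists B : 'L(X, X),
    (forall x, B (U x - l *: x) = x) /\ (forall x, U (B x) - l *: B x = x).
  move=> l1; have [B [H1 H2]] : exists B, is_inverse (U - l *: (idfun : 'L(X, X))) B.
    apply: contrapT => /sU/= l1'; move: l1; rewrite -rnorm_normc /rnorm l1'.
    by rewrite eqxx.
  by exists B.
move=> e e1.
have resU z : normc z < 1 -> exists B : 'L(X, X),
    (forall x, B (x - z *: U x) = x) /\ (forall x, B x - z *: U (B x) = x).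
  have [->|z0] := eqVneq z 0.
    by exists (idfun : 'L(X, X)); split=> x /=; rewrite scale0r subr0.
  move=> z1; have [|B [B1 B2]] := inv z^-1.
    rewrite normcV gt_eqF// invf_gt1// -?normcE.
    by rewrite lt_def normc_ge0 andbT; apply: contra z0 => /eqP/eq0_normc ->.
  pose B' : 'L(X, X) := - z^-1 *: B.
  have B'E x : B' x = - z^-1 *: B x by [].
  exists B'; split=> x; rewrite !B'E.
    have -> : x - z *: U x = - z *: (U x - z^-1 *: x).
      by rewrite scalerBr !scaleNr scalerA mulfV// scale1r opprK addrC.
    by rewrite linearZ/= scalerA mulrNN mulVf// scale1r B1.
  rewrite [U _]linearZ/= scalerA mulrN mulfV// scaleN1r opprK scaleNr addrC.
  exact: B2.
have resV z : normc z < 1 -> exists B : 'L(X, X),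
    (forall x, B (x - z *: V x) = x) /\ (forall x, B x - z *: V (B x) = x).
  move=> z1; have [|B [B1 B2]] := inv z; first by rewrite lt_eqF.
  exists (U \o B : 'L(X, X)); split=> x /=.
    by rewrite -{1}[x]VU B1 VU.
  by rewrite UV B2.
have [C C0 HC] := power_growth resU e1.
have [D D0 HD] := power_growth resV e1.
have ge0 n x : 0 <= e ^+ n * rnorm x.
  by rewrite mulr_ge0 ?rnorm_ge0// exprn_ge0// ltW// (lt_trans ltr01).
exists (C + D); first exact: addr_gt0.
move=> n x; split; [rewrite (le_trans (HC n x))//|rewrite (le_trans (HD n x))//].
  by rewrite -!mulrA ler_wpM2r// lerDl ltW.
by rewrite -!mulrA ler_wpM2r// lerDr ltW.
Qed.

Lemma Kaplansky_setup (R : realType) (K : compactHausdorffType)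
    (X : completeNormedModType R[i]) (m : CK R K -> 'L(X, X))
    (U V : 'L(X, X)) (phi psi : continuousType K K) :
  is_Kaplansky_module m -> is_inverse U V ->
  spectrum U `<=` [set z | `|z| = 1] ->
  cancel phi psi -> cancel psi phi ->
  (forall f : CK R K, (U \o m f \o V : 'L(X, X)) = m (CK_comp f phi)) ->
  (forall k : K, ~ periodic_point phi k) ->
  weighted_setup m U V phi psi.
Proof.
move=> [hm ed _] UV sU phiK psiK com aper; have [UK VK] := UV.
have mP a f g x : m (a *: f + g) x = a *: m f x + m g x.
  by rewrite (module_linear hm).
have m0 x : m 0 x = 0.
  have := mP 1 0 0 x; rewrite !scale1r addr0.
  by move/eqP; rewrite -subr_eq0 opprD addrA subrr sub0r oppr_eq0 => /eqP.
split=> //.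
- by move=> f g x; rewrite -[f in LHS]scale1r mP scale1r.
- by move=> a f x; rewrite -[a *: f]addr0 mP m0 addr0.
- exact: moduleM hm.
- exact: module1 hm.
- move=> f c x c0 fc; rewrite (le_trans (L_rnorm _ _))// ler_wpM2r ?rnorm_ge0//.
  by rewrite /rnorm (module_isom hm); apply/CK_rnormP.
- move=> f f0; apply: (module_inj hm); apply: LP => x.
  by rewrite f0 m0.
- by move=> f x; rewrite -com /= UK.
- exact: (spectrum_growth UV sU).
Qed.

Section CK_module.
Variables (R : realType) (K : compactHausdorffType).
Variables (phi psi : continuousType K K).

Definition CK_mult (f : CK R K) : 'L(CK R K, CK R K) :=
  weighted_comp f (idfun : continuousType K K).

Lemma CK_multE f g : CK_mult f g = f * g.
Proof. by apply: CKP. Qed.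

Lemma weighted_comp1 (chi : continuousType K K) (f : CK R K) :
  weighted_comp 1 chi f = CK_comp f chi.
Proof. by apply: CKP => k; rewrite -[LHS]/(1 * f (chi k)) mul1r. Qed.

(** Compositions with [phi] and [psi] do not increase the supremum norm, so growth holds with
    constant 1. *)
Lemma CK_setup : extremally_disconnected K ->
  cancel phi psi -> cancel psi phi ->
  (forall k : K, ~ periodic_point phi k) ->
  weighted_setup CK_mult (weighted_comp 1 phi) (weighted_comp 1 psi) phi psi.
Proof.
move=> ed phiK psiK aper; split=> //.
- by move=> f g x; rewrite !CK_multE mulrDl.
- move=> a f x; rewrite !CK_multE; apply: CKP => k.
  by rewrite -[LHS]/(a * f k * x k) -[RHS]/(a * (f k * x k)) mulrA.
- by move=> f g x; rewrite !CK_multE mulrA.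
- by move=> x; rewrite CK_multE mul1r.
- move=> f c x c0 fc; rewrite CK_multE; apply/CK_rnormP.
    by rewrite mulr_ge0 ?rnorm_ge0.
  move=> k; rewrite -[(f * x) k]/(f k * x k) normcM ler_pM ?normc_ge0//.
  exact: ((CK_rnormP _ (rnorm_ge0 _)).1 (lexx _)).
- by move=> f /(_ 1); rewrite CK_multE mulr1.
- move=> f; rewrite !weighted_comp1; apply: CKP => k.
  by rewrite -[LHS]/(f (phi (psi k))) psiK.
- move=> f; rewrite !weighted_comp1; apply: CKP => k.
  by rewrite -[LHS]/(f (psi (phi k))) phiK.
- by move=> f g; rewrite !weighted_comp1 !CK_multE; apply: CKP.
move=> e e1; exists 1 => // n x.
have contr (chi : continuousType K K) :
    rnorm (iter n (weighted_comp 1 chi) x) <= 1 * e ^+ n * rnorm x.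
  apply: (@le_trans _ _ (rnorm x)).
    elim: n => // n IH; rewrite iterS weighted_comp1; apply: le_trans IH.
    set y := iter _ _ _; apply/CK_rnormP; first exact: rnorm_ge0.
    by move=> k; apply: ((CK_rnormP y (rnorm_ge0 y)).1 (lexx _)).
  by rewrite mul1r ler_peMl ?rnorm_ge0// exprn_ege1// ltW.
by split; exact: contr.
Qed.

End CK_module.

Unset Implicit Arguments.
Set Strict Implicit.

Theorem theorem5p4 (R : realType) (K : compactHausdorffType)
    (X : completeNormedModType R[i]) (m : CK R K -> 'L(X, X))
    (hm : is_Kaplansky_module m)
    (U Uinv : 'L(X, X)) (hU : d_isomorphism m U) (hUinv : is_inverse U Uinv)
    (hUT : spectrum U `<=` [set z | `|z| = 1])
    (w : CK R K) (phi : continuousType K K) (hphi : homeomorphism phi)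
    (hUphi : forall f : CK R K,
      (U \o m f \o Uinv : 'L(X, X)) = m (CK_comp f phi))
    (hper : forall k : K, ~ periodic_point phi k) :
  let T : 'L(X, X) := m w \o U in
  let S : 'L(CK R K, CK R K) := weighted_comp w phi in
  ap_spectrum T = ap_spectrum S /\ res_spectrum T = res_spectrum S.
Proof.
move=> T S; have [psi [phiK psiK]] := hphi.
have S1 := Kaplansky_setup hm hUinv hUT phiK psiK hUphi hper.
have S2 := CK_setup R (Kaplansky_extr hm) phiK psiK hper.
have c1 := @complete_geometric R X; have c2 := @CK_geometric R K.
(* [S] is the weighted operator of [C(K)] acting on itself, which makes the transfer available in
   both directions. *)
have SE : S = (CK_mult w \o weighted_comp 1 phi : 'L(CK R K, CK R K)).
  apply: LP => f; rewrite -[RHS]/(CK_mult w (weighted_comp 1 phi f)).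
  by rewrite weighted_comp1 CK_multE.
have bb l : bounded_below T l <-> bounded_below S l.
  rewrite SE; split; first exact: (bounded_below_transfer S1 S2).
  exact: (bounded_below_transfer S2 S1).
have inv l : bounded_below T l /\ (forall y, exists z, T z - l *: z = y) <->
    bounded_below S l /\ (forall y, exists z, S z - l *: z = y).
  rewrite SE; split; first exact: (invertible_transfer S1 S2 c1 c2).
  exact: (invertible_transfer S2 S1 c2 c1).
have ap : ap_spectrum T = ap_spectrum S.
  by apply/funext => l; apply/propext; rewrite !ap_spectrumP bb.
have sp : spectrum T = spectrum S.
  by apply/funext => l; apply/propext; rewrite !spectrumP inv.
by rewrite /res_spectrum ap sp.
Qed.
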